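(* Let $d\in\mathbb{Z}_{\ge1}$ and $k\in\mathbb{Z}_{\ge0}$. Then $\mathrm{Flt}(d,k)$ is an algebraic number.
   Context: $\mathcal{K}^d$ is the set of convex bodies (non-empty compact convex sets) in $\mathbb{R}^d$. $\mathrm{G}^\circ(K)$ is the number of points of $\mathbb{Z}^d$ in the interior of $K$. The lattice width is $\mathrm{w}(K)=\inf_{u\in\mathbb{Z}^d\setminus\{0\}}\left(\max_{x\in K}\langle u,x\rangle-\min_{x\in K}\langle u,x\rangle\right)$. $\mathrm{Flt}(d,k)=\sup\{\mathrm{w}(K):K\in\mathcal{K}^d,\ \mathrm{G}^\circ(K)\le k\}$. Algebraic means: root of a non-zero polynomial with rational coefficients. *)

(* Defs.v *)
From mathcomp Require Import all_boot all_order all_algebra.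
From mathcomp Require Import all_classical all_reals all_analysis.
Set Implicit Arguments.
Unset Strict Implicit.
Unset Printing Implicit Defensive.
Import Order.TTheory GRing.Theory Num.Theory numFieldNormedType.Exports.
Local Open Scope classical_set_scope.
Local Open Scope ring_scope.

Definition convex_body (R : realType) (d : nat) (K : set 'rV[R]_d) : Prop :=
  [/\ K !=set0, compact K & convex_set K].

Definition interior_lattice_points (R : realType) (d : nat)
    (K : set 'rV[R]_d) : set 'rV[int]_d :=
  [set z | interior K (map_mx intr z)].

Definition pairing (R : realType) (d : nat) (u : 'rV[int]_d)
    (x : 'rV[R]_d) : R :=
  \sum_(i < d) (u 0 i)%:~R * x 0 i.

(* On a convex body the supremum and infimum are the maximum and minimum of a
   continuous function on a non-empty compact set. *)
Definition directional_width (R : realType) (d : nat) (K : set 'rV[R]_d)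
    (u : 'rV[int]_d) : R :=
  sup [set pairing u x | x in K] - inf [set pairing u x | x in K].

Definition lattice_width (R : realType) (d : nat) (K : set 'rV[R]_d) : R :=
  inf [set directional_width K u | u in [set u : 'rV[int]_d | u != 0]].

(* The supremum is taken in the extended reals, since the real-valued [sup]
   would silently return 0 on an unbounded set.  [#<= `I_k] says that there are
   at most [k] interior lattice points. *)
Definition Flt (R : realType) (d k : nat) : \bar R :=
  ereal_sup [set (lattice_width K)%:E | K in
    [set K : set 'rV[R]_d |
      convex_body K /\ (interior_lattice_points K #<= `I_k)%card]].

(* Main.v *)
Require Import Defs.
From mathcomp Require Import all_boot all_order all_algebra.
From mathcomp Require Import all_classical all_reals all_analysis.
From mathcomp Require Import ring lra zify.

(** The proof is by induction on the dimension.  Let [W] be the flatness constant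
    of lattice-free bodies one dimension lower.  A body with at most [k] interior
    lattice points and width at least [w0 > W] contains no long segment in a
    lattice direction: otherwise its projection along that direction, slightly
    shrunk, would be lattice-free and too wide.  Reducing the seminorm
    [u |-> width of K in direction u] on the lattice then yields a unimodular
    image of [K] in a box that depends on [w0] only, so that [Flt] is finite.

    Cylinders give [W <= Flt], and if equality holds the induction hypothesis
    concludes.  If [W < Flt], only finitely many lattice points and directions
    matter inside the box, and [Flt] is the maximum of a coordinate [t] on a
    compact set defined by finitely many polynomial conditions over [rat].  If
    the maximal value were transcendental, the maximiser could be deformed with
    all its polynomial relations preserved while [t] increases, a
    contradiction. *)

Set Implicit Arguments.
Unset Strict Implicit.
Unset Printing Implicit Defensive.
Import Order.TTheory GRing.Theory Num.Theory Num.Def numFieldNormedType.Exports.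
Local Open Scope classical_set_scope.
Local Open Scope ring_scope.

(** * Separation of convex bodies *)

Section Dot.
Context {R : realType} {d : nat}.
Implicit Types (a b x y : 'rV[R]_d) (K : set 'rV[R]_d).

(** Two obstacles shape the proof. No box can hold at widths below [W]: a cylinder over a
    lattice-free body of width close to [W] may be arbitrarily long. Hence the threshold [w0] lies
    strictly above [W], and equality is treated apart. Only lattice-free bodies matter one dimension
    lower, whatever [k] is, because a long fibre over a single lattice point already carries more
    than [k] lattice points.

    The other obstacle is the passage from a maximum to an algebraic number, which usually rests on
    quantifier elimination. Here a deformation does it: moving a transcendental [t] to [t + 1 / n]
    breaks no polynomial relation over [rat], and the remaining coordinates are adjoined one at a
    time. Equations then persist exactly and strict inequalities persist by continuity. Since the
    width is an infimum over infinitely many directions, the reduction to finitely many rests on a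
    coercivity bound uniform over all bodies concerned, so that it also covers the deformed one. *)

Definition dot a x : R := \sum_(i < d) a 0 i * x 0 i.

Lemma dotC a x : dot a x = dot x a.
Proof. by apply: eq_bigr => i _; rewrite mulrC. Qed.

Lemma dotDr a x y : dot a (x + y) = dot a x + dot a y.
Proof. by rewrite -big_split; apply: eq_bigr => i _; rewrite mxE mulrDr. Qed.

Lemma dotZr a t x : dot a (t *: x) = t * dot a x.
Proof. by rewrite mulr_sumr; apply: eq_bigr => i _; rewrite mxE mulrCA. Qed.

Lemma dotNr a x : dot a (- x) = - dot a x.
Proof. by rewrite -scaleN1r dotZr mulN1r. Qed.

Lemma dotBr a x y : dot a (x - y) = dot a x - dot a y.
Proof. by rewrite dotDr dotNr. Qed.

Lemma dotDl a b x : dot (a + b) x = dot a x + dot b x.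
Proof. by rewrite dotC dotDr !(dotC x). Qed.

Lemma dotZl a t x : dot (t *: a) x = t * dot a x.
Proof. by rewrite dotC dotZr dotC. Qed.

Lemma dotNl a x : dot (- a) x = - dot a x.
Proof. by rewrite dotC dotNr dotC. Qed.

Lemma dotBl a b x : dot (a - b) x = dot a x - dot b x.
Proof. by rewrite dotDl dotNl. Qed.

Lemma dot_sqrB t a x :
  dot (t *: x - a) (t *: x - a) = dot a a - 2 * t * dot a x + t ^+ 2 * dot x x.
Proof. rewrite !(dotBl, dotBr, dotZl, dotZr) (dotC x a); ring. Qed.

Lemma dot_ge0 a : 0 <= dot a a.
Proof. by apply: sumr_ge0 => i _; rewrite -expr2 sqr_ge0. Qed.

Lemma dot_eq0 a : dot a a = 0 -> a = 0.
Proof.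
move=> /eqP; rewrite psumr_eq0; last by move=> i _; rewrite -expr2 sqr_ge0.
move=> /allP h; apply/rowP => i; rewrite mxE; apply/eqP.
by rewrite -sqrf_eq0 expr2; apply: h; rewrite mem_index_enum.
Qed.

Lemma dot_gt0 a : a != 0 -> 0 < dot a a.
Proof.
by move=> a0; rewrite lt_neqAle dot_ge0 andbT eq_sym; apply: contra a0 => /eqP/dot_eq0->.
Qed.

Lemma dot_le a x (A B : R) : (forall i, `|a 0 i| <= A) ->
  (forall i, `|x 0 i| <= B) -> dot a x <= d%:R * (A * B).
Proof.
move=> hA hB; rewrite -[d in d%:R]card_ord mulr_natl -sumr_const.
apply: ler_sum => i _; apply: le_trans (ler_norm _) _.
by rewrite normrM ler_pM.
Qed.

Lemma coord_le_norm x i : `|x 0 i| <= `|x|.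
Proof.
have /mapP[j Hj ->] : `|x 0 i| \in [seq `|x k.1 k.2| | k : 'I_1 * 'I_d].
  by apply/mapP; exists (0, i) => //=; rewrite mem_enum.
by rewrite [leRHS]/Num.norm /= mx_normrE; apply/bigmax_geP; right => /=; exists j.
Qed.

Lemma norm_le_coord x (e : R) : 0 <= e -> (forall i, `|x 0 i| <= e) -> `|x| <= e.
Proof.
move=> e0 h; rewrite [leLHS]/Num.norm /= mx_normrE; apply/bigmax_leP; split=> //.
by case=> i j _ /=; rewrite ord1.
Qed.

Lemma interior_rowP K x : interior K x <->
  exists2 e : R, 0 < e & forall y, (forall i, `|y 0 i - x 0 i| < e) -> K y.
Proof.
split.
  move=> /nbhs_ballP[e /= e0 he]; exists e => // y hy; apply: he; split=> // i j.
  by rewrite ord1 /ball /= distrC; exact: hy.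
case=> e e0 he; apply/nbhs_ballP; exists e => //= y [_ hy]; apply: he => i.
by have := hy 0 i; rewrite /ball /= distrC.
Qed.

Lemma continuous_dot (T : topologicalType) (f g : T -> 'rV[R]_d) :
  (forall i, continuous (fun t => f t 0 i)) ->
  (forall i, continuous (fun t => g t 0 i)) ->
  continuous (fun t => dot (f t) (g t)).
Proof.
move=> cf cg t.
suff h s : \sum_(i <- s) f u 0 i * g u 0 i @[u --> t] --> \sum_(i <- s) f t 0 i * g t 0 i.
  exact: h.
elim: s => [|i s IHs].
  by rewrite big_nil; under [fun _ => _]funext do rewrite big_nil; exact: cvg_cst.
rewrite big_cons; under [fun _ => _]funext do rewrite big_cons.
by apply: cvgD IHs; apply: cvgM; [exact: cf|exact: cg].
Qed.

Lemma convexP K : convex_set K <->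
  forall x y (t : R), K x -> K y -> 0 <= t -> t <= 1 -> K (t *: x + (1 - t) *: y).
Proof.
split.
  move=> cK x y t Kx Ky t0 t1.
  have t01 : 0 <= t <= 1 by rewrite t0.
  have := cK x y (@Itv01 R t t0 t1).
  by rewrite !inE => /(_ Kx Ky).
move=> h x y t; rewrite !inE => Kx Ky; exact: h.
Qed.

Lemma compact_bounded_coord K : compact K ->
  exists2 B : R, 0 < B & forall x, K x -> forall i, `|x 0 i| <= B.
Proof.
move=> /compact_bounded/ex_strict_bound_gt0[B B0 hB]; exists B => // x Kx i.
by apply: le_trans (coord_le_norm _ _) _; exact/ltW/hB.
Qed.

(* [a] points from the nearest point of [K] to [p]. *)
Lemma separation K p : K !=set0 -> compact K -> convex_set K -> ~ K p ->
  exists2 a, a != 0 & forall x, K x -> dot a x + dot a a <= dot a p.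
Proof.
move=> K0 cK /convexP vK nKp.
pose f x := dot (x - p) (x - p).
have cf : continuous f.
  suff c i : continuous (fun x => (x - p) 0 i) by exact: continuous_dot.
  move=> t; rewrite (_ : (fun x => _) = (fun x : 'rV[R]_d => x 0 i - p 0 i)).
    by apply: (cvgB (F := nbhs t)); [exact: coord_continuous|exact: cvg_cst].
  by apply/funext => x; rewrite !mxE.
have [|y /set_mem Ky hy] := compact_EVT_min K0 cK (f := f).
  exact: continuous_subspaceT.
exists (p - y).
  by rewrite subr_eq0; apply/eqP => py; apply: nKp; rewrite py.
move=> x Kx; set a := p - y.
suff h : dot a (x - y) <= 0.
  have -> : dot a a = dot a p - dot a y by rewrite /a dotBr.
  by move: h; rewrite dotBr; lra.
rewrite leNgt; apply/negP => s0; set s := dot a (x - y) in s0.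
set M := dot (x - y) (x - y).
have M0 : 0 <= M by exact: dot_ge0.
(* A step from [y] towards [x], short enough for the gain [2 * t * s] to beat the loss [t ^+ 2 * M];
   the summand [s] in the denominator keeps [t <= 1] and covers [M = 0]. *)
pose t := s / (M + s).
have Ms : 0 < M + s by lra.
have t0 : 0 < t by rewrite divr_gt0.
have t1 : t <= 1 by rewrite ler_pdivrMr//; lra.
have := hy _ (mem_set (vK x y t Kx Ky (ltW t0) t1)).
have -> : f (t *: x + (1 - t) *: y) = f y - 2 * t * s + t ^+ 2 * M.
  rewrite /f.
  have -> : t *: x + (1 - t) *: y - p = t *: (x - y) - a.
    by rewrite /a scalerBl scalerBr scale1r; apply/rowP => i; rewrite !mxE; ring.
  have -> : y - p = - a by rewrite /a opprB.
  by rewrite dot_sqrB dotNl dotNr opprK.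
have tM : t * (M + s) = s by rewrite /t divfK// gt_eqF.
nra.
Qed.

(** Points outside [K] converge to [z]; the normals separating them from [K], scaled to sup norm 1,
    have a cluster point on the compact unit sphere. This covers at once [z] outside [K], [z] on the
    boundary, and bodies with empty interior. *)
Lemma support K z : K !=set0 -> compact K -> convex_set K -> ~ interior K z ->
  exists2 a, a != 0 & forall x, K x -> dot a x <= dot a z.
Proof.
move=> K0 cK vK nz.
have step (n : nat) : exists a, `|a| = 1 /\
    forall x, K x -> dot a (x - z) <= d%:R * n.+1%:R^-1.
  have [p [hp nKp]] : exists p : 'rV[R]_d,
      (forall i, `|p 0 i - z 0 i| < n.+1%:R^-1) /\ ~ K p.
    apply: contrapT => h; apply: nz; apply/interior_rowP.
    exists n.+1%:R^-1; first by rewrite invr_gt0.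
    by move=> y hy; apply: contrapT => nKy; apply: h; exists y.
  have [a a0 ha] := separation K0 cK vK nKp.
  have na : `|a| != 0 by rewrite normr_eq0.
  have na0 : 0 < `|a| by rewrite normr_gt0.
  exists (`|a|^-1 *: a); split.
    by rewrite normrZ normfV normr_id mulVf.
  move=> x Kx; rewrite dotZl.
  have h1 : dot a (x - z) <= dot a (p - z).
    by rewrite !dotBr; have := ha _ Kx; have := dot_ge0 a; lra.
  have h2 : dot a (p - z) <= d%:R * (`|a| * n.+1%:R^-1).
    apply: dot_le; first exact: coord_le_norm.
    by move=> i; rewrite !mxE; exact/ltW/hp.
  rewrite ler_pdivrMl//; apply: le_trans h1 _; apply: le_trans h2 _.
  by rewrite mulrCA.
have [a_ ha] := choice step.
pose S := [set a : 'rV[R]_d | `|a| = 1].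
have cS : compact S.
  apply: bounded_closed_compact.
    by exists 1; split=> // M M1 a /= ->; exact: ltW.
  rewrite (_ : S = (fun a => `|a|) @^-1` [set (1 : R)])//.
  apply: preimage_closed; last exact: closed_eq.
  by move=> a _; exact: norm_continuous.
have [|a [Sa cla]] := cS (a_ @ \oo) _.
  by exists 0%N => // n _; case: (ha n).
exists a; first by rewrite -normr_gt0 Sa.
move=> x Kx; rewrite -subr_ge0 -dotBr -[_ - _]opprB dotNr oppr_ge0.
rewrite leNgt; apply/negP; set e := dot a (x - z) => e0.
have c1 : continuous (fun b : 'rV[R]_d => dot b (x - z)).
  by apply: continuous_dot => i; [exact: coord_continuous|exact: cst_continuous].
have n1 : nbhs a [set b | e / 2 < dot b (x - z)].
  by apply: (cvgr_gt (f := fun b => dot b (x - z)) _ (c1 a)); rewrite -/e; lra.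
have [N hN] : exists N : nat, d%:R * N.+1%:R^-1 < e / 2 :> R.
  exists (Num.truncn (d%:R / (e / 2))); rewrite ltr_pdivrMr// mulrC -ltr_pdivrMr; last lra.
  by have := truncnS_gt (d%:R / (e / 2) : R).
have n2 : (a_ @ \oo) [set a_ n | n in [set n | (N <= n)%N]].
  by exists N => // n /= Nn; exists n.
have [b [[n /= Nn <-] /= hb]] := cla _ _ n2 n1.
suff h : d%:R * n.+1%:R^-1 <= d%:R * N.+1%:R^-1 :> R.
  by have := lt_trans (lt_le_trans hb (le_trans ((ha n).2 _ Kx) h)) hN; rewrite ltxx.
by rewrite ler_wpM2l// lef_pV2 ?posrE// ler_nat.
Qed.

(** Converse of [support]. Together they turn interiority into a statement on normals, which
    transform linearly under projections and affine maps. *)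
Lemma interior_support K z a : interior K z ->
  (forall x, K x -> dot a x <= dot a z) -> a = 0.
Proof.
move=> /interior_rowP[e e0 he] ha; apply/eqP; case: (eqVneq a 0) => // a0.
have na0 : 0 < `|a| by rewrite normr_gt0.
pose t := e / 2 / `|a|.
have t0 : 0 < t by rewrite !divr_gt0.
have /ha : K (z + t *: a).
  apply: he => i; rewrite !mxE addrAC subrr add0r normrM (gtr0_norm t0).
  have := coord_le_norm a i; have ta : t * `|a| = e / 2 by rewrite divfK// gt_eqF.
  nra.
rewrite dotDr dotZr; have := dot_gt0 a0; nra.
Qed.

End Dot.

(** * Widths and unimodular images *)

Section Cards.
Local Open Scope card_scope.

Lemma card_le_inj T U (A : set T) (B : set U) (f : T -> U) :
  {in A &, injective f} -> (forall x, A x -> B (f x)) -> A #<= B.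
Proof.
move=> fi fAB; rewrite -(card_le_eql (inj_card_eq fi)).
by apply: subset_card_le => _ [x Ax <-]; exact: fAB.
Qed.

Lemma card_le_II_inj T (A : set T) (k m : nat) (f : nat -> T) :
  {in `I_m &, injective f} -> (forall j, (j < m)%N -> A (f j)) ->
  A #<= `I_k -> (m <= k)%N.
Proof.
move=> fi fA Ak; rewrite -card_le_II; apply: card_le_trans Ak.
exact: card_le_inj fi fA.
Qed.

Lemma card_le_finset (T : finType) U (A : set U) (S : {set T}) (f : T -> U) (k : nat) :
  (#|S| <= k)%N -> A `<=` f @` [set` S] -> A #<= `I_k.
Proof.
move=> Sk AS; apply: card_le_trans (subset_card_le AS) _.
apply: card_le_trans (card_image_le _ _) _.
apply: (@card_le_inj _ _ _ _ (fun x => index x (enum S))).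
  move=> x y; rewrite !inE /= => xS yS /(congr1 (nth x (enum S))).
  by rewrite !nth_index ?mem_enum.
by move=> x /= xS; rewrite (leq_trans _ Sk)// cardE index_mem mem_enum.
Qed.

Lemma finset_card_le (T : finType) U (A : set U) (S : {set T}) (f : T -> U) (k : nat) :
  injective f -> (forall x, x \in S -> A (f x)) -> A #<= `I_k -> (#|S| <= k)%N.
Proof.
move=> fi fA; have [->|[x0 _]] := set_0Vmem S; first by rewrite cards0.
apply: (@card_le_II_inj _ _ _ _ (fun j => f (nth x0 (enum S) j))).
  move=> i j; rewrite !inE /= cardE => iS jS /fi /eqP.
  by rewrite nth_uniq ?enum_uniq// => /eqP.
by move=> j jS; apply: fA; rewrite -mem_enum mem_nth// -cardE.
Qed.

End Cards.

Section Width.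
Context {R : realType} {d : nat}.
Implicit Types (a b x y : 'rV[R]_d) (K : set 'rV[R]_d).

(** Real directions are allowed because reduction and coercivity use the width as a seminorm on the
    whole space. *)
Definition rwidth K a : R :=
  sup [set dot a x | x in K] - inf [set dot a x | x in K].

Lemma directional_widthE K u : directional_width K u = rwidth K (map_mx intr u).
Proof.
rewrite /directional_width /rwidth (_ : pairing u = dot (map_mx intr u))//.
by apply/funext => x; apply: eq_bigr => i _; rewrite mxE.
Qed.

Lemma rwidth_attained K a : convex_body K ->
  exists x y, [/\ K x, K y & rwidth K a = dot a x - dot a y].
Proof.
move=> [K0 cK _].
have cd : continuous (dot a).
  by apply: continuous_dot => i; [exact: cst_continuous|exact: coord_continuous].
have [|x /set_mem Kx hx] := compact_EVT_max K0 cK (f := dot a).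
  exact: continuous_subspaceT.
have [|y /set_mem Ky hy] := compact_EVT_min K0 cK (f := dot a).
  exact: continuous_subspaceT.
exists x, y; split=> //.
have nS : [set dot a x | x in K] !=set0 by exists (dot a x), x.
rewrite /rwidth; congr (_ - _); apply/eqP; rewrite eq_le; apply/andP; split.
- by apply: ge_sup => // _ [z Kz <-]; apply: hx; rewrite inE.
- apply: ub_le_sup; last by exists x.
  by exists (dot a x) => _ [z Kz <-]; apply: hx; rewrite inE.
- apply: ge_inf; last by exists y.
  by exists (dot a y) => _ [z Kz <-]; apply: hy; rewrite inE.
- by apply: lb_le_inf => // _ [z Kz <-]; apply: hy; rewrite inE.
Qed.

Lemma rwidth_ge K a x y : convex_body K -> K x -> K y ->
  dot a x - dot a y <= rwidth K a.
Proof.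
move=> [K0 cK _] Kx Ky.
have [B B0 hB] := compact_bounded_coord cK.
have aB i : `|a 0 i| <= `|a| by exact: coord_le_norm.
apply: lerB.
  apply: ub_le_sup; last by exists x.
  by exists (d%:R * (`|a| * B)) => _ [z Kz <-]; apply: dot_le => // i; exact: hB.
apply: ge_inf; last by exists y.
exists (- (d%:R * (`|a| * B))) => _ [z Kz <-]; rewrite lerNl -dotNr.
by apply: dot_le => // i; rewrite mxE normrN; exact: hB.
Qed.

Lemma rwidth_leP K a (t : R) : convex_body K ->
  rwidth K a <= t <-> forall x y, K x -> K y -> dot a x - dot a y <= t.
Proof.
move=> bK; split=> [h x y Kx Ky|h]; first exact: le_trans (rwidth_ge _ bK Kx Ky) h.
by have [x [y [Kx Ky ->]]] := rwidth_attained a bK; exact: h.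
Qed.

Lemma rwidthD K a b : convex_body K -> rwidth K (a + b) <= rwidth K a + rwidth K b.
Proof.
move=> bK; apply/rwidth_leP => // x y Kx Ky; rewrite !dotDl.
by have := rwidth_ge a bK Kx Ky; have := rwidth_ge b bK Kx Ky; lra.
Qed.

Lemma rwidth_ge0 K a : convex_body K -> 0 <= rwidth K a.
Proof.
by move=> bK; have [[x Kx] _ _] := bK; have := rwidth_ge a bK Kx Kx; rewrite subrr.
Qed.

Lemma rwidthZ K t a : convex_body K -> rwidth K (t *: a) = `|t| * rwidth K a.
Proof.
move=> bK; apply/eqP; rewrite eq_le; apply/andP; split.
  apply/rwidth_leP => // x y Kx Ky; rewrite !dotZl -mulrBr.
  have h1 := rwidth_ge a bK Kx Ky; have h2 := rwidth_ge a bK Ky Kx.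
  apply: le_trans (ler_norm _) _; rewrite normrM ler_wpM2l// ler_norml; lra.
have [x [y [Kx Ky ->]]] := rwidth_attained a bK.
have [t0|t0] := lerP 0 t.
  by rewrite ger0_norm// mulrBr -!dotZl; exact: rwidth_ge.
by rewrite ltr0_norm// mulNr -mulrN opprB mulrBr -!dotZl; exact: rwidth_ge.
Qed.

Lemma lattice_width_le K u : convex_body K -> u != 0 ->
  lattice_width K <= directional_width K u.
Proof.
move=> bK u0; apply: ge_inf; last by exists u.
by exists 0 => _ [v _ <-]; rewrite directional_widthE rwidth_ge0.
Qed.

End Width.

Lemma lattice_width_geP (R : realType) n (K : set 'rV[R]_n.+1) (w : R) :
  convex_body K -> w <= lattice_width K <->
  forall u, u != 0 -> w <= directional_width K u.
Proof.
move=> bK; split=> [h u u0|h]; first exact: le_trans h (lattice_width_le bK u0).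
apply: lb_le_inf; last by move=> _ [u u0 <-]; exact: h.
by exists (directional_width K (const_mx 1)), (const_mx 1) => //;
  apply/eqP => /rowP/(_ 0); rewrite !mxE.
Qed.

Section Affine.
Context {R : realType} {d m : nat}.
Implicit Types (K : set 'rV[R]_d) (A : 'M[R]_(d, m)) (b : 'rV[R]_m).

Definition aff A b K : set 'rV[R]_m := [set x *m A + b | x in K].

Lemma dot_mulmx a A x : dot a (x *m A) = dot (a *m A^T) x.
Proof.
rewrite /dot; under eq_bigr do rewrite mxE mulr_sumr.
rewrite exchange_big /=; apply: eq_bigr => i _; rewrite mxE mulr_suml.
by apply: eq_bigr => j _; rewrite [A^T _ _]mxE; ring.
Qed.

Lemma continuous_rowP (T : topologicalType) (f : T -> 'rV[R]_m) :
  (forall i, continuous (fun t => f t 0 i)) -> continuous f.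
Proof.
move=> cf t; apply/cvgrPdist_lt => e e0.
have h : \forall u \near t, forall i, `|f t 0 i - f u 0 i| < e / 2.
  apply: filter_forall => i; have /cvgrPdist_lt := cf i t; apply.
  by rewrite divr_gt0.
near=> u; apply: (@le_lt_trans _ _ (e / 2)); last lra.
apply: norm_le_coord; first lra.
by move=> i; rewrite !mxE; apply: ltW; move: i; near: u.
Unshelve. all: by end_near. Qed.

Lemma convex_body_aff A b K : convex_body K -> convex_body (aff A b K).
Proof.
move=> [[x Kx] cK /convexP vK]; split; first by exists (x *m A + b), x.
  apply: continuous_compact => //; apply: continuous_subspaceT.
  apply: continuous_rowP => i t.
  rewrite (_ : (fun y => _) = (fun y => dot y (row i A^T) + b 0 i)).
    have cd : continuous (fun y : 'rV[R]_d => dot y (row i A^T)).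
      by apply: continuous_dot => j; [exact: coord_continuous|exact: cst_continuous].
    by apply: (cvgD (F := nbhs t)); [exact: cd|exact: cvg_cst].
  apply/funext => y; rewrite !mxE; congr (_ + _).
  by apply: eq_bigr => j _; rewrite !mxE.
apply/convexP => _ _ t [y Ky <-] [z Kz <-] t0 t1.
exists (t *: y + (1 - t) *: z); first exact: vK.
rewrite mulmxDl -!scalemxAl !scalerDr addrACA -scalerDl addrCA subrr addr0.
by rewrite scale1r.
Qed.

Lemma rwidth_aff A b K a : convex_body K ->
  rwidth (aff A b K) a = rwidth K (a *m A^T).
Proof.
move=> bK; have bA := convex_body_aff A b bK.
apply/eqP; rewrite eq_le; apply/andP; split; apply/rwidth_leP => //.
  move=> _ _ [x Kx <-] [y Ky <-]; rewrite !dotDr opprD addrACA subrr addr0.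
  by rewrite !dot_mulmx; exact: rwidth_ge.
move=> x y Kx Ky; rewrite -!dot_mulmx.
suff -> : dot a (x *m A) - dot a (y *m A) = dot a (x *m A + b) - dot a (y *m A + b).
  by apply: rwidth_ge => //; [exists x|exists y].
by rewrite !dotDr; ring.
Qed.

End Affine.

(** A non-zero normal at the preimage of [z], multiplied by [B^T], would support the image at its
    interior point [z]. *)
Lemma interior_aff (R : realType) d (K : set 'rV[R]_d) (A B : 'M[R]_d) b z :
  convex_body K -> B *m A = 1%:M -> interior (aff A b K) z ->
  interior K ((z - b) *m B).
Proof.
move=> [K0 cK vK] BA iz; apply: contrapT => /(support K0 cK vK)[a a0 ha].
move/eqP: a0; apply.
have AB : A *m B = 1%:M by apply: mulmx1C.
have /(congr1 (mulmx^~ A^T)) : a *m B^T = 0.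
  apply: (interior_support iz) => _ [x Kx <-].
  rewrite -!dot_mulmx mulmxDl -mulmxA AB mulmx1 dotDr.
  have := ha _ Kx; rewrite mulmxBl dotBr; lra.
by rewrite mul0mx -mulmxA -trmx_mul AB trmx1 mulmx1.
Qed.

Section Unimodular.
Context {R : realType} {d : nat}.
Notation intm := (map_mx (intr : int -> R)).

(** The transpose lets [V] act on directions: up to translation, coordinate [i] of the image is the
    functional given by row [i] of [V], which is how [lattice_reduction] delivers its basis. *)
Definition unimod (V : 'M[int]_d) (s : 'rV[int]_d) (K : set 'rV[R]_d) :=
  aff (intm V)^T (intm s) K.

Lemma directional_width_unimod V s K u : convex_body K ->
  directional_width (unimod V s K) u = directional_width K (u *m V).
Proof.
by move=> bK; rewrite !directional_widthE rwidth_aff// trmxK map_mxM.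
Qed.

Lemma card_unimod V s (K : set 'rV[R]_d) (k : nat) :
  V \in unitmx -> convex_body K ->
  (interior_lattice_points K #<= `I_k)%card ->
  (interior_lattice_points (unimod V s K) #<= `I_k)%card.
Proof.
move=> uV bK; apply: card_le_trans.
apply: (card_le_inj (f := fun z => (z - s) *m (invmx V)^T)).
  move=> y z _ _ /(congr1 (mulmx^~ V^T)).
  by rewrite -!mulmxA -trmx_mul mulmxV// trmx1 !mulmx1 => /addIr.
move=> z; rewrite /interior_lattice_points /= => iz.
rewrite map_mxM map_mxB -map_trmx; apply: interior_aff iz => //.
by rewrite -trmx_mul -map_mxM mulmxV// map_mx1 trmx1.
Qed.

End Unimodular.

(** * Reduction of a seminorm on the lattice *)

Section Reduction.
Context {R : realType}.
Notation intm := (map_mx (intr : int -> R)).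

Definition seminorm d (N : 'rV[R]_d -> R) :=
  (forall a b, N (a + b) <= N a + N b) /\ (forall t a, N (t *: a) = `|t| * N a).

Lemma seminorm_ge0 d (N : 'rV[R]_d -> R) a : seminorm N -> 0 <= N a.
Proof.
move=> [ND NZ]; have := ND a ((-1) *: a); rewrite scaleN1r subrr -[- a]scaleN1r NZ.
by rewrite -(scale0r (0 : 'rV[R]_d)) NZ normr0 mul0r normrN1; lra.
Qed.

(** The Smith form of a single row has at most one non-zero entry, the first, so [u] is a multiple
    of the first row of the right unimodular factor. *)
Lemma primitive_completion n (u : 'rV[int]_n.+1) :
  exists g V, V \in unitmx /\ u = g *: row 0 V.
Proof.
have [L _ [V uV [s _ ->]]] := int_Smith_normal_form u.
exists (L 0 0 * s`_0), V; split=> //; apply/rowP => j.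
rewrite !mxE (bigD1 0)//= big1 ?addr0.
  by rewrite !mxE big_ord1 mxE eqxx mulr1n.
move=> i i0; rewrite mxE big_ord1 mxE /=.
have -> : (0 == i :> nat)%N = false by rewrite eq_sym; exact: negbTE i0.
by rewrite mulr0n mulr0 mul0r.
Qed.

Lemma row_unit_neq0 n (V : 'M[int]_n) i : V \in unitmx -> row i V != 0.
Proof.
move=> uV; apply/eqP => /(congr1 (mulmx^~ (invmx V))).
rewrite -row_mul mulmxV// mul0mx => /rowP/(_ i)/eqP.
by rewrite !mxE eqxx.
Qed.

Lemma mulmx_unit_neq0 n (V : 'M[int]_n) (u : 'rV_n) :
  V \in unitmx -> u != 0 -> u *m V != 0.
Proof.
move=> uV; apply: contraNneq => /(congr1 (mulmx^~ (invmx V))).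
by rewrite mulmxK// mul0mx => ->.
Qed.

Lemma row_mx_neq0r n (a : 'rV[int]_1) (c : 'rV[int]_n) : c != 0 -> row_mx a c != 0.
Proof.
by apply: contraNneq => /(congr1 rsubmx); rewrite row_mxKr => ->; rewrite raddf0.
Qed.

Lemma mul_row_lblock1 n (c : 'rV[R]_(1 + n)) (s : 'cV[int]_n) (V : 'M[int]_n) :
  c *m intm (block_mx 1%:M 0 s V : 'M[int]_(1 + n)) =
    row_mx (lsubmx c + rsubmx c *m intm s) (rsubmx c *m intm V).
Proof.
rewrite -[c in LHS]hsubmxK map_block_mx mul_row_block map_mx0 map_mx1.
by rewrite mulmx0 mulmx1 add0r.
Qed.

Lemma int_round (t : R) : exists k : int, `|k%:~R - t| <= 1 / 2.
Proof.
exists (Num.floor (t + 1 / 2)).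
have := floor_le_tmp (t + 1 / 2); have := floorD1_gt (t + 1 / 2).
by rewrite intrD ler_norml; set z := (_%:~R : R); lra.
Qed.

(* Recursion on the quotient by an almost shortest primitive vector, the
   quotient norm being an infimum over the real line that it spans.  The
   coefficient of the last basis vector is controlled by the norm of the
   one-dimensional quotient reached at the end. *)
Lemma lattice_reduction n : exists2 C : R, 0 < C &
  forall (N : 'rV[R]_n.+1 -> R) (lam : R), seminorm N -> 0 < lam ->
    (forall u, u != 0 -> lam <= N (intm u)) ->
  exists (V : 'M[int]_n.+1) (q : R), [/\ V \in unitmx,
    forall c : 'rV[R]_n.+1, `|c 0 ord_max| * q <= N (c *m intm V) &
    forall i, N (intm (row i V)) <= C * q].
Proof.
elim: n => [|n [C C0 IH]].
  exists 1 => // N lam [ND NZ] lam0 hN.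
  exists 1%:M, (N (const_mx 1)); split; first exact: unitmx1.
    move=> c; rewrite map_mx1 mulmx1 -NZ le_eqVlt; apply/orP; left; apply/eqP.
    by congr N; apply/rowP => i; rewrite !mxE mulr1 !ord1; congr (c _ _); apply/val_inj.
  move=> i; rewrite mul1r le_eqVlt; apply/orP; left; apply/eqP.
  by congr N; apply/rowP => j; rewrite !mxE !ord1.
(* The short vector will have norm at most [20 / 3 * (C * q)], and the lifted rows at most
   [2 * C * q + m / 2], that is [16 / 3 * (C * q)]; the factor 7 dominates both. *)
exists (7 * C); first by rewrite mulr_gt0.
move=> N lam sN lam0 hN; have [ND NZ] := sN.
pose S := [set N (intm u) | u in [set u : 'rV[int]_n.+2 | u != 0]].
have S0 : S !=set0.
  exists (N (intm (const_mx 1))), (const_mx 1) => //.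
  by apply/eqP => /rowP/(_ 0); rewrite !mxE.
have hS : has_inf S by split=> //; exists lam => _ [u u0 <-]; exact: hN.
set lam1 := inf S.
have hlam : lam <= lam1 by apply: lb_le_inf => // _ [u u0 <-]; exact: hN.
have {hN} hN u : u != 0 -> lam1 <= N (intm u).
  by move=> u0; apply: ge_inf; [case: hS|exists u].
(* A vector within a factor [5 / 4] of the infimum avoids any question of attainment. Rounding along
   it costs at most [m / 2 <= 5 / 8 * lam1], which leaves the [3 / 8 * lam1] of [pos] for the
   quotient norm. *)
have e0 : 0 < lam1 / 4 by lra.
have [_ [u u0 <-] hu] := inf_adherent e0 hS.
have [g [V1 [uV1 ue]]] := primitive_completion u.
pose m := N (intm (row 0 V1)).
have hm1 : lam1 <= m by apply: hN; exact: row_unit_neq0.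
have hm2 : m <= 5 / 4 * lam1.
  have g1 : 1 <= `|g%:~R : R|.
    rewrite -intr_norm ler1z -gtz0_ge1 normr_gt0; apply: contra u0 => /eqP g0.
    by rewrite ue g0 scale0r.
  have : N (intm u) = `|g%:~R| * m by rewrite ue map_mxZ NZ.
  by rewrite -/lam1 in hu; nra.
pose ext (t : R) (c : 'rV[R]_n.+1) : 'rV[R]_n.+2 :=
  (row_mx t%:M c : 'rV_(1 + n.+1)) *m intm V1.
have extD t s c e : ext t c + ext s e = ext (t + s) (c + e).
  by rewrite /ext -mulmxDl add_row_mx -raddfD.
have extZ a t c : a *: ext t c = ext (a * t) (a *: c).
  by rewrite /ext scalemxAl scale_row_mx scale_scalar_mx.
have ext0 t : ext t 0 = t *: intm (row 0 V1).
  apply/rowP => j; rewrite !mxE (@big_split_ord _ _ _ 1) /= big_ord1 big1 => [|k _].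
    by rewrite addr0 row_mxEl !mxE eqxx mulr1n; congr (_ * (V1 _ _)%:~R); exact/val_inj.
  by rewrite row_mxEr mxE mul0r.
have extint k c : ext k%:~R (intm c) = intm ((row_mx k%:M c : 'rV_(1 + n.+1)) *m V1).
  by rewrite /ext map_mxM map_row_mx map_scalar_mx.
have ext_round t k c : N (ext k c) <= N (ext t c) + `|k - t| * m.
  have -> : ext k c = ext t c + (k - t) *: intm (row 0 V1).
    by rewrite -ext0 extD addr0 addrC subrK.
  by apply: le_trans (ND _ _) _; rewrite NZ.
pose N' c := inf [set N (ext t c) | t in setT].
have lbN c : has_lbound [set N (ext t c) | t in setT].
  by exists 0 => _ [t _ <-]; exact: seminorm_ge0.
have hN'le c t : N' c <= N (ext t c) by apply: ge_inf => //; exists t.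
have neN c : [set N (ext t c) | t in setT] !=set0 by exists (N (ext 0 c)), 0.
have hN'adh c e : 0 < e -> exists t, N (ext t c) < N' c + e.
  move=> e1; have [|_ [t _ <-] ht] := inf_adherent (E := [set N (ext t c) | t in setT]) e1.
    by split.
  by exists t.
have N'Zle a c : a != 0 -> N' (a *: c) <= `|a| * N' c.
  move=> a0; have a0' : 0 < `|a| by rewrite normr_gt0.
  rewrite -ler_pdivrMl//; apply: lb_le_inf => // _ [t _ <-].
  by rewrite ler_pdivrMl// -NZ extZ.
have sN' : seminorm N'.
  split=> [a b|a c].
    apply/ler_addgt0Pr => e e1; have e2 : 0 < e / 2 by lra.
    have [t ht] := hN'adh a _ e2; have [s hs] := hN'adh b _ e2.
    have := hN'le (a + b) (t + s); rewrite -extD.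
    by have := ND (ext t a) (ext s b); lra.
  have [->|a0] := eqVneq a 0.
    rewrite scale0r normr0 mul0r; apply/eqP; rewrite eq_le; apply/andP; split.
      have := hN'le 0 0; rewrite ext0 NZ normr0; lra.
    by apply: lb_le_inf => // _ [t _ <-]; exact: seminorm_ge0.
  apply/eqP; rewrite eq_le N'Zle//=.
  have := N'Zle a^-1 (a *: c); rewrite invr_neq0// scalerA mulVf// scale1r.
  by rewrite normfV ler_pdivlMl ?normr_gt0//; exact.
have pos c : c != 0 -> 3 / 8 * lam1 <= N' (intm c).
  move=> c0; apply: lb_le_inf => // _ [t _ <-].
  have [k hk] := int_round t; have := ext_round t k%:~R (intm c).
  rewrite extint; set w := (_ *m V1).
  have : lam1 <= N (intm w).
    apply: hN; apply: mulmx_unit_neq0 => //; exact: row_mx_neq0r.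
  by nra.
have lam3 : 0 < 3 / 8 * lam1 by lra.
have [V' [q [uV' hV'1 hV'2]]] := IH N' _ sN' lam3 pos.
(* The slack in the infimum [N'] is taken equal to its value, which is positive by [pos]: hence the
   factor 2. Rounding [t] to an integer adds [m / 2]. *)
have lift i : exists k : int, N (ext k%:~R (intm (row i V'))) <= 2 * C * q + m / 2.
  have p := pos _ (row_unit_neq0 i uV').
  have [|t ht] := hN'adh (intm (row i V')) (N' (intm (row i V'))); first lra.
  have [k hk] := int_round t; exists k.
  have := ext_round t k%:~R (intm (row i V')); have := hV'2 i; nra.
have [k_ hk] := choice lift.
(* A lifted row is a non-zero lattice vector, so [lam1 <= 2 * C * q + 5 / 8 * lam1]: the short
   vector is itself controlled by the [q] of the quotient. *)
have hm : m <= 20 / 3 * (C * q).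
  have : lam1 <= N (ext (k_ 0)%:~R (intm (row 0 V'))).
    rewrite extint; apply: hN; apply: mulmx_unit_neq0 => //.
    exact/row_mx_neq0r/row_unit_neq0.
  by have := hk 0; lra.
have Cq : 0 <= C * q by nra.
pose V2 : 'M[int]_(1 + n.+1) := block_mx 1%:M 0 (\col_i k_ i) V'.
exists (V2 *m V1), q; split.
- by rewrite unitmx_mul uV1 andbT unitmxE /V2 (@det_lblock _ 1) det1 mul1r -unitmxE.
- move=> c; rewrite map_mxM mulmxA.
  have -> : c *m intm V2 *m intm V1 =
      ext ((lsubmx (c : 'rV_(1 + n.+1)) +
            rsubmx (c : 'rV_(1 + n.+1)) *m intm (\col_i k_ i)) 0 0)
        (rsubmx (c : 'rV_(1 + n.+1)) *m intm V').
    by rewrite /ext -mx11_scalar [c *m intm V2]mul_row_lblock1.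
  apply: le_trans (hN'le _ _); apply: le_trans (hV'1 _).
  rewrite mxE (_ : rshift 1 ord_max = ord_max)//; exact/val_inj.
- move=> i; rewrite row_mul; case: (split_ordP (i : 'I_(1 + n.+1))) => j ->.
    rewrite [row _ V2](rowKu j (row_mx 1%:M 0) (row_mx _ V')) row_row_mx row0.
    rewrite ord1 rowE mulmx1.
    have -> : delta_mx 0 0 = (1%:~R)%:M :> 'rV[int]_1.
      by apply/rowP => l; rewrite !mxE ord1.
    have := ext0 1; rewrite scale1r -[1]/(1%:~R) -(map_mx0 (intr : int -> R)) extint => ->.
    by rewrite -/m; lra.
  rewrite [row _ V2](rowKd j (row_mx 1%:M 0) (row_mx _ V')) row_row_mx.
  have -> : row j (\col_i k_ i) = (k_ j)%:M.
    by apply/rowP => l; rewrite !mxE ord1 eqxx mulr1n.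
  by rewrite -extint; have := hk j; lra.
Qed.

End Reduction.

(** * Boundedness up to unimodular equivalence *)

Section Projection.
Context {R : realType} {n : nat}.
Variable j0 : 'I_n.+1.
Notation intm := (map_mx (intr : int -> R)).

Definition drop_mx (T : pzSemiRingType) : 'M[T]_(n.+1, n) :=
  \matrix_(i, j) (i == lift j0 j)%:R.

Lemma mul_drop_mx (T : pzSemiRingType) (x : 'rV[T]_n.+1) j :
  (x *m drop_mx T) 0 j = x 0 (lift j0 j).
Proof.
rewrite mxE (bigD1 (lift j0 j))//= mxE eqxx mulr1 big1 ?addr0// => i ij.
by rewrite mxE (negbTE ij) mulr0.
Qed.

Lemma mul_drop_trmx (T : comPzRingType) (c : 'rV[T]_n) j :
  (c *m (drop_mx T)^T) 0 (lift j0 j) = c 0 j.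
Proof.
rewrite mxE (bigD1 j)//= !mxE eqxx mulr1 big1 ?addr0// => i ij.
by rewrite !mxE (inj_eq lift_inj) eq_sym (negbTE ij) mulr0.
Qed.

Lemma map_drop_mx : intm (drop_mx int) = drop_mx R.
Proof. by apply/matrixP => i j; rewrite !mxE; case: (i == _). Qed.

Lemma dot_lift (a x : 'rV[R]_n.+1) :
  dot a x = a 0 j0 * x 0 j0 + dot (a *m drop_mx R) (x *m drop_mx R).
Proof.
rewrite /dot (bigD1_ord j0)//=; congr (_ + _); apply: eq_bigr => i _.
by rewrite !mul_drop_mx.
Qed.

Definition insert_coord (T : Type) (s : T) (z : 'rV[T]_n) : 'rV[T]_n.+1 :=
  \row_i oapp (z 0) s (unlift j0 i).

Lemma insert_coordE (T : Type) (s : T) z : insert_coord s z 0 j0 = s.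
Proof. by rewrite mxE unlift_none. Qed.

Lemma insert_coord_lift (T : Type) (s : T) z j : insert_coord s z 0 (lift j0 j) = z 0 j.
Proof. by rewrite mxE liftK. Qed.

Lemma insert_coord_drop (T : pzSemiRingType) (s : T) z : insert_coord s z *m drop_mx T = z.
Proof. by apply/rowP => j; rewrite mul_drop_mx insert_coord_lift. Qed.

Lemma map_insert_coord s z : intm (insert_coord s z) = insert_coord s%:~R (intm z).
Proof. by apply/rowP => i; rewrite !mxE; case: (unlift _ _) => [j|]//=; rewrite mxE. Qed.

End Projection.

Section Flatness.
Context {R : realType}.
Notation intm := (map_mx (intr : int -> R)).

(** Phrased with lower bounds [w] on all directional widths, since the induction starts in dimension
    0, where there is no non-zero direction and [lattice_width] is an infimum over the empty set. *)
Definition flat n (W : R) := forall (K : set 'rV[R]_n) w, convex_body K ->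
  interior_lattice_points K = set0 ->
  (forall u, u != 0 -> w <= directional_width K u) -> w <= W.

(* Shrinking the projection of [K] towards the projection of the segment keeps
   the fibres long, so that a lattice point interior to the shrunk projection
   lifts to more than [k] interior lattice points of [K]. *)
Lemma segment_bound n W (k : nat) (w0 : R) : flat n W -> 0 <= W -> W < w0 ->
  exists2 L : R, 0 < L & forall (j0 : 'I_n.+1) (K : set 'rV[R]_n.+1), convex_body K ->
    (interior_lattice_points K #<= `I_k)%card ->
    (forall u, u != 0 -> w0 <= directional_width K u) ->
  forall y q, K y -> K (y + q *: delta_mx 0 j0) -> q < L.
Proof.
move=> fW W0 Ww0.
have w00 : 0 < w0 by lra.
(* Chosen so that the projection shrunk by [1 - e] keeps width at least
   [(1 - e) * w0 = (w0 + W) / 2], still above [W]. *)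
pose e := (w0 - W) / (2 * w0).
have e0 : 0 < e by rewrite divr_gt0//; lra.
have ew : e * w0 = (w0 - W) / 2 by rewrite /e; field; rewrite gt_eqF.
have e1 : e <= 1 by rewrite ler_pdivrMr; lra.
have k0 : 0 < k.+2%:R :> R by [].
(* Over a point of the shrunk projection, [K] contains a segment of length [e * q]; length [k + 2]
   guarantees [k + 1] integers strictly inside. *)
exists (k.+2%:R / e); first by rewrite divr_gt0.
move=> j0 K bK Kk Kw y q Ky Kyq; rewrite ltNge; apply/negP.
rewrite ler_pdivrMr// => hq.
have [K0 cK vK0] := bK; have /convexP vK := vK0.
pose P := @drop_mx n j0 R.
pose K' := aff ((1 - e) *: P) (e *: (y *m P)) K.
have bK' : convex_body K' by exact: convex_body_aff.
have K'P x : (1 - e) *: x *m P + e *: (y *m P) = ((1 - e) *: x + e *: y) *m P.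
  by rewrite mulmxDl -!scalemxAl.
have K'P2 x : x *m ((1 - e) *: P) + e *: (y *m P) = ((1 - e) *: x + e *: y) *m P.
  by rewrite -K'P -scalemxAr -scalemxAl.
have mix x z : K x -> K z -> K ((1 - e) *: x + e *: z).
  by move=> Kx Kz; rewrite addrC; apply: vK => //; lra.
have [z iz] : interior_lattice_points K' !=set0.
  apply/set0P/eqP => K'0.
  suff : (1 - e) * w0 <= W by lra.
  apply: (fW K') => // u u0; rewrite directional_widthE rwidth_aff//.
  have -> : ((1 - e) *: P)^T = (1 - e) *: P^T by apply/matrixP => i j; rewrite !mxE.
  rewrite -scalemxAr rwidthZ// ger0_norm; last lra.
  rewrite ler_wpM2l//; first lra.
  rewrite /P -map_drop_mx map_trmx -map_mxM -directional_widthE; apply: Kw.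
  apply: contraNneq u0 => h; apply/eqP/rowP => j.
  by rewrite -(mul_drop_trmx j0) h !mxE.
have /= := interior_subset iz; move=> [x Kx]; rewrite K'P2 => xz.
set x1 := (1 - e) *: x + e *: y in xz.
have Kx1 : K x1 by exact: mix.
have Kx2 : K (x1 + (e * q) *: delta_mx 0 j0).
  by rewrite -addrA -scalerA -scalerDr; exact: mix.
pose s0 := x1 0 j0.
have lift_int s : s0 < s%:~R -> s%:~R < s0 + e * q ->
    interior_lattice_points K (insert_coord j0 s z).
  move=> hs1 hs2; rewrite /interior_lattice_points /=.
  apply: contrapT => /(support K0 cK vK0).
  case=> a a0 ha.
  have E : dot a (intm (insert_coord j0 s z)) = a 0 j0 * s%:~R + dot (a *m P) (intm z).
    by rewrite map_insert_coord (dot_lift j0) insert_coordE insert_coord_drop.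
  (* A normal at a point strictly inside a segment of [K] is orthogonal to the segment. It therefore
     descends to a normal of [K'] at the interior point [z] and vanishes. *)
  have a00 : a 0 j0 = 0.
    have := ha _ Kx1; have := ha _ Kx2; rewrite E dotDr dotZr (dot_lift j0 a x1) xz -/s0.
    rewrite (dot_lift j0 a (delta_mx _ _)).
    have -> : delta_mx 0 j0 *m drop_mx j0 R = (0 : 'rV[R]_n).
      by apply/rowP => j; rewrite mul_drop_mx !mxE /= eq_sym (negbTE (neq_lift _ _)).
    have -> : dot (a *m drop_mx j0 R) 0 = 0 by rewrite -(scale0r 0) dotZr mul0r.
    rewrite !mxE !eqxx /=; nra.
  move/eqP: a0; apply.
  have aP : a *m P = 0.
    apply: (interior_support iz) => _ [x' Kx' <-]; rewrite K'P2.
    have := ha _ (mix _ _ Kx' Ky); rewrite E (dot_lift j0) a00 !mul0r !add0r; exact.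
  apply/rowP => i; rewrite mxE; have [j ->|->//] := unliftP j0 i.
  by rewrite -mul_drop_mx -/P aP mxE.
have : (k.+1 <= k)%N.
  pose f (j : nat) := insert_coord j0 (Num.floor s0 + 1 + j%:Z) z.
  apply: (@card_le_II_inj _ _ _ _ f) Kk.
    move=> i j _ _ /rowP/(_ j0); rewrite !insert_coordE => /addrI; lia.
  move=> j jk; apply: lift_int.
    have := floorD1_gt s0; have : 0 <= j%:R :> R by [].
    by rewrite !intrD /=; lra.
  have : j%:R <= k%:R :> R by rewrite ler_nat -ltnS.
  have := floor_le_tmp s0; rewrite !intrD /=.
  move: hq; rewrite -addn2 natrD; set z1 := (_%:~R : R); lra.
by rewrite ltnn.
Qed.

(** By polarity, the lower bound on the seminorm in [lattice_reduction] says that the difference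
    body of the reduced image contains [q] times the last unit vector. So the image contains a
    segment of length [q] in that direction, [segment_bound] gives [q < L], and the widths in the
    coordinate directions are at most [C * q], hence at most [C * L]. *)
Lemma unimodular_box n W (k : nat) (w0 : R) : flat n W -> 0 <= W -> W < w0 ->
  exists D : nat, forall K : set 'rV[R]_n.+1, convex_body K ->
    (interior_lattice_points K #<= `I_k)%card ->
    (forall u, u != 0 -> w0 <= directional_width K u) ->
  exists (V : 'M[int]_n.+1) s, V \in unitmx /\
    forall x, unimod V s K x -> forall i, `|x 0 i| <= D%:R.
Proof.
move=> fW W0 Ww0.
have [L L0 hL] := segment_bound k fW W0 Ww0.
have [C C0 hC] := lattice_reduction (R := R) n.
exists (Num.truncn (C * L + 1)).+1 => K bK Kk Kw.
have w00 : 0 < w0 by lra.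
have sN : seminorm (rwidth K).
  by split=> *; [exact: rwidthD|exact: rwidthZ].
have [|V [q [uV hq hV]]] := hC _ _ sN w00.
  by move=> u u0; rewrite -directional_widthE; exact: Kw.
pose K1 := unimod V 0 K.
have bK1 : convex_body K1 by exact: convex_body_aff.
have wK1 a : rwidth K1 a = rwidth K (a *m intm V) by rewrite rwidth_aff// trmxK.
have [[x0 Kx0] cK1 /convexP vK1] := bK1.
pose DK := [set p.1 - p.2 | p in K1 `*` K1].
have [[x y] /= [Kx Ky] xyq] : DK (q *: delta_mx 0 ord_max).
  apply: contrapT => /separation[].
  - by exists (x0 - x0), (x0, x0).
  - apply: continuous_compact; last exact: compact_setX.
    apply: continuous_subspaceT; apply: continuous_rowP => i p.
    rewrite (_ : (fun t => _) = (fun t : 'rV[R]_n.+1 * 'rV[R]_n.+1 => t.1 0 i - t.2 0 i)).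
      have c1 : continuous (fun v : 'rV[R]_n.+1 => v 0 i) by exact: coord_continuous.
      apply: (cvgB (F := nbhs p)).
        apply: (@continuous_comp _ _ _ fst (fun v : 'rV[R]_n.+1 => v 0 i) p); last exact: c1.
        exact: cvg_fst.
      apply: (@continuous_comp _ _ _ snd (fun v : 'rV[R]_n.+1 => v 0 i) p); last exact: c1.
      exact: cvg_snd.
    by apply/funext => t; rewrite !mxE.
  - apply/convexP => _ _ t [[x y] /= [Kx Ky] <-] [[x' y'] /= [Kx' Ky'] <-] t0 t1.
    exists (t *: x + (1 - t) *: x', t *: y + (1 - t) *: y') => /=.
      by split; exact: vK1.
    by rewrite !scalerBr opprD addrACA.
  move=> a a0 ha.
  have [x1 [y1 [Kx1 Ky1 wxy]]] := rwidth_attained a bK1.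
  have := ha (x1 - y1); rewrite dotBr -wxy.
  have : DK (x1 - y1) by exists (x1, y1).
  move=> /[swap] /[apply].
  rewrite dotZr wK1; have := hq a; have := dot_gt0 a0.
  have -> : dot a (delta_mx 0 ord_max) = a 0 ord_max.
    rewrite /dot (bigD1 ord_max)//= mxE !eqxx mulr1 big1 ?addr0// => i io.
    by rewrite mxE (negbTE io) andbF mulr0.
  have : 0 <= q.
    by have := hV 0; have := seminorm_ge0 (intm (row 0 V)) sN; nra.
  have := ler_norm (a 0 ord_max); nra.
have qL : q < L.
  apply: (hL ord_max K1 bK1 _ _ y) => //.
  - exact: card_unimod.
  - move=> u u0; rewrite directional_width_unimod//; apply: Kw.
    exact: mulmx_unit_neq0.
  - by rewrite -xyq addrC subrK.
(* An integer translation brings [x0] within 1 of the origin in each coordinate, which explains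
   [C * L + 1] in the size of the box. *)
exists V, (map_mx (fun t => - Num.floor t) x0); split=> //.
move=> _ [p Kp <-] i.
have hp : `|(p *m (intm V)^T) 0 i - x0 0 i| <= C * L.
  have di v : dot (delta_mx 0 i) v = v 0 i :> R.
    rewrite dotC /dot (bigD1 i)//= mxE !eqxx mulr1 big1 ?addr0// => j ji.
    by rewrite mxE (negbTE ji) andbF mulr0.
  have Kp1 : K1 (p *m (intm V)^T) by exists p => //; rewrite map_mx0 addr0.
  have h1 := rwidth_ge (delta_mx 0 i) bK1 Kp1 Kx0.
  have h2 := rwidth_ge (delta_mx 0 i) bK1 Kx0 Kp1.
  have : rwidth K1 (delta_mx 0 i) <= C * L.
    rewrite wK1 -rowE -map_row; apply: le_trans (hV i) _; nra.
  by rewrite ler_norml; move: h1 h2; rewrite !di; lra.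
rewrite -[(truncn _).+1]addn1.
have := truncnS_gt (C * L + 1).
have := floor_le_tmp (x0 0 i); have := floorD1_gt (x0 0 i).
rewrite !mxE in hp *; rewrite intrD intrN.
move: hp; rewrite !ler_norml addn1; set z1 := (_%:~R : R); lra.
Qed.

End Flatness.

(** * Deformation of a transcendental number *)

Section Germs.
Context {R : realType}.
Implicit Types (S : R -> (nat -> R) -> Prop) (p : {poly R}) (P : nat -> {poly R}).

(* [S a f] reads: the sequence [f] is a deformation of the number [a].  The zero
   clause makes every polynomial relation between the deformed numbers persist
   along the deformation. *)
Record germs S : Prop := Germs {
  germs_ratr : forall q : rat, S (ratr q) (fun=> ratr q);
  germsD : forall a b f g, S a f -> S b g -> S (a + b) (fun n => f n + g n);
  germsM : forall a b f g, S a f -> S b g -> S (a * b) (fun n => f n * g n);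
  germs_cvg : forall a f, S a f -> f @ \oo --> a;
  germs0P : forall f, S 0 f -> \forall n \near \oo, f n = 0 }.

Lemma germs_int S (k : int) : germs S -> S k%:~R (fun=> k%:~R).
Proof. by move=> gS; have := germs_ratr gS k%:~R; rewrite ratr_int. Qed.

Lemma germs0 S : germs S -> S 0 (fun=> 0).
Proof. by move=> gS; exact: (germs_int 0 gS). Qed.

Lemma germsN S a f : germs S -> S a f -> S (- a) (fun n => - f n).
Proof.
move=> gS Sa; have := germsM gS (germs_int (- 1) gS) Sa; rewrite intrN mulN1r.
by congr S; apply/funext => n; rewrite mulN1r.
Qed.

Lemma germsB S a b f g : germs S -> S a f -> S b g -> S (a - b) (fun n => f n - g n).
Proof. by move=> gS Sa Sb; apply: germsD => //; exact: germsN. Qed.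

Lemma germs_sum S (I : Type) (s : seq I) (a : I -> R) (f : I -> nat -> R) : germs S ->
  (forall i, S (a i) (f i)) -> S (\sum_(i <- s) a i) (fun n => \sum_(i <- s) f i n).
Proof.
move=> gS h; elim: s => [|i s IHs].
  by rewrite big_nil; under [fun n => _]funext do rewrite big_nil; exact: germs0.
rewrite big_cons (_ : (fun n => _) = fun n => f i n + \sum_(j <- s) f j n).
  exact: germsD.
by apply/funext => n; rewrite big_cons.
Qed.

Lemma germs_gt0 S a f : germs S -> S a f -> 0 < a -> \forall n \near \oo, 0 < f n.
Proof. by move=> gS /(germs_cvg gS) fa a0; exact: (cvgr_gt _ fa). Qed.

(** A positive limit gives positivity by convergence; a zero limit needs the zero clause, since
    convergence alone would allow negative terms. *)
Lemma germs_ge0 S a f : germs S -> S a f -> 0 <= a -> \forall n \near \oo, 0 <= f n.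
Proof.
move=> gS Sa; rewrite le_eqVlt => /orP[/eqP a0|a0]; last first.
  by near=> n; apply: ltW; near: n; exact: germs_gt0 gS Sa a0.
move: Sa; rewrite -a0 => /(germs0P gS) f0; near=> n.
by have -> // : f n = 0 by near: n.
Unshelve. all: by end_near. Qed.

Lemma germs_neq0 S a f : germs S -> S a f -> a != 0 -> \forall n \near \oo, f n != 0.
Proof.
move=> gS Sa; rewrite neq_lt => /orP[a0|a0].
  have aN : 0 < - a by rewrite oppr_gt0.
  near=> n; have : 0 < - f n by near: n; exact: germs_gt0 gS (germsN gS Sa) aN.
  by rewrite oppr_gt0 => /lt_eqF ->.
by near=> n; rewrite gt_eqF//; near: n; exact: germs_gt0 gS Sa a0.
Unshelve. all: by end_near. Qed.

(** The size bound [m], common to all [n], reduces eventual statements on [P n] to finitely many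
    coefficient sequences. *)
Definition germ_poly S (m : nat) p P :=
  [/\ (size p <= m)%N, forall n, (size (P n) <= m)%N &
      forall i, S p`_i (fun n => (P n)`_i)].

(** The ring obtained by adjoining [x] to the numbers of [S], with [x] deformed along [X]. It is not
    made a field: pseudo-division takes the place of inverses. *)
Definition germ_ext S x (X : nat -> R) a f :=
  exists m p P, [/\ germ_poly S m p P, a = p.[x] & forall n, f n = (P n).[X n]].

Lemma germ_poly0P S m P : germs S -> germ_poly S m 0 P -> \forall n \near \oo, P n = 0.
Proof.
move=> gS [_ h2 h3].
have h : \forall n \near \oo, forall i : 'I_m, (P n)`_i = 0.
  by apply: filter_forall => i; apply: (germs0P gS); have := h3 i; rewrite coef0.
near=> n; have hn : forall i : 'I_m, (P n)`_i = 0 by near: n.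
apply/polyP => i; rewrite coef0; have [im|mi] := ltnP i m.
  exact: (hn (Ordinal im)).
by rewrite nth_default// (leq_trans (h2 n)).
Unshelve. all: by end_near. Qed.

Lemma germ_poly_cvg S m p P x (X : nat -> R) : germs S -> germ_poly S m p P ->
  X @ \oo --> x -> (P n).[X n] @[n --> \oo] --> p.[x].
Proof.
move=> gS [h1 h2 h3] Xx; rewrite (horner_coef_wide _ h1).
under [fun n => _]funext => n do rewrite (horner_coef_wide _ (h2 n)).
elim: (index_enum _) => [|i s IHs].
  by rewrite big_nil; under [fun n => _]funext do rewrite big_nil; exact: cvg_cst.
rewrite big_cons; under [X in X @ _]funext do rewrite big_cons.
apply: cvgD IHs; apply: cvgM; first exact: (germs_cvg gS (h3 i)).
elim: (i : nat) => [|k IHk].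
  by under [fun n => _]funext do rewrite expr0; exact: cvg_cst.
by rewrite exprS; under [fun n => _]funext do rewrite exprS; exact: cvgM.
Qed.

Lemma germ_polyC S a f : germs S -> S a f -> germ_poly S 1 a%:P (fun n => (f n)%:P).
Proof.
move=> gS Sa; split=> [|n|i]; rewrite ?size_polyC_leq1//.
rewrite coefC; under [fun n => _]funext do rewrite coefC.
by case: (i == 0)%N => //; exact: germs0.
Qed.

Lemma germ_extW S x X a f : germs S -> S a f -> germ_ext S x X a f.
Proof.
move=> gS Sa; exists 1%N, a%:P, (fun n => (f n)%:P); split; first exact: germ_polyC.
  by rewrite hornerC.
by move=> n; rewrite hornerC.
Qed.

Lemma germ_ext_gen S x X : germs S -> germ_ext S x X x X.
Proof.
move=> gS; exists 2%N, 'X, (fun=> 'X); split.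
- split=> [|n|i]; rewrite ?size_polyX//.
  rewrite /= !coefX.
  by case: (i == 1)%N; [exact: (germs_int 1 gS)|exact: germs0].
- by rewrite hornerX.
- by move=> n; rewrite hornerX.
Qed.

(** Polynomial arithmetic and continuity give all clauses but the zero clause. That one depends on
    the choice of [X], and the last hypothesis is exactly it. *)
Lemma germs_ext S x X : germs S -> X @ \oo --> x ->
  (forall m p P, germ_poly S m p P -> p.[x] = 0 ->
    \forall n \near \oo, (P n).[X n] = 0) ->
  germs (germ_ext S x X).
Proof.
move=> gS Xx h0; split.
- by move=> q; apply: germ_extW => //; exact: germs_ratr.
- move=> a b f g [m [p [P [[h1 h2 h3] -> hf]]]] [k [q [Q [[k1 k2 k3] -> hg]]]].
  exists (maxn m k), (p + q), (fun n => P n + Q n); split; first split.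
  + by rewrite (leq_trans (size_polyD _ _))// geq_max !leq_max h1 k1 orbT.
  + by move=> n; rewrite (leq_trans (size_polyD _ _))// geq_max !leq_max h2 k2 orbT.
  + move=> i; rewrite coefD; under [fun n => _]funext do rewrite coefD.
    exact: germsD.
  + by rewrite hornerD.
  + by move=> n; rewrite hornerD hf hg.
- move=> a b f g [m [p [P [[h1 h2 h3] -> hf]]]] [k [q [Q [[k1 k2 k3] -> hg]]]].
  exists (m + k)%N, (p * q), (fun n => P n * Q n); split; first split.
  + by rewrite (leq_trans (size_polyMleq _ _))// (leq_trans (leq_pred _))// leq_add.
  + by move=> n; rewrite (leq_trans (size_polyMleq _ _))// (leq_trans (leq_pred _))// leq_add.
  + move=> i; rewrite coefM; under [X in S _ X]funext do rewrite coefM.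
    by apply: germs_sum => // j; exact: germsM.
  + by rewrite hornerM.
  + by move=> n; rewrite hornerM hf hg.
- move=> _ f [m [p [P [hp -> hf]]]].
  by rewrite (_ : f = fun n => (P n).[X n]); [exact: germ_poly_cvg hp Xx|exact/funext].
- move=> f [m [p [P [hp p0 hf]]]]; near=> n; rewrite hf; near: n.
  exact: h0 hp (esym p0).
Unshelve. all: by end_near. Qed.

(** The only relation at [x] is the zero polynomial, whose deformation is eventually zero
    coefficient by coefficient. Hence any sequence tending to [x] is admissible, which is the
    freedom used to move [t]. *)
Lemma germs_ext_transcendental S x X : germs S -> X @ \oo --> x ->
  (forall m p P, germ_poly S m p P -> p.[x] = 0 -> p = 0) ->
  germs (germ_ext S x X).
Proof.
move=> gS Xx h; apply: germs_ext => // m p P hp px.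
have p0 := h _ _ _ hp px; rewrite p0 in hp.
by near=> n; have -> : P n = 0; [near: n; exact: germ_poly0P hp|rewrite horner0].
Unshelve. all: by end_near. Qed.

(** A simple root is a sign change, sign changes survive small perturbations of the coefficients,
    and the intermediate value theorem returns a root. *)
Lemma root_near S m p P x : germs S -> germ_poly S m p P -> p.[x] = 0 ->
  p^`().[x] != 0 -> forall e : R, 0 < e ->
  \forall n \near \oo, exists2 y, root (P n) y & `|y - x| <= e.
Proof.
move=> gS hp px p'x e e0.
have [r pe] : exists r, p = r * ('X - x%:P).
  by apply/factor_theorem; rewrite /root px.
have rx : r.[x] != 0.
  move: p'x; rewrite pe derivM derivXsubC mulr1 !hornerE /=.
  by rewrite subrr mulr0 add0r.
have [h [h0 he hr]] : exists h, [/\ 0 < h, h <= e & 0 < r.[x + h] * r.[x - h]].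
  have /cvgrPdist_lt/(_ `|r.[x]|) := @continuous_horner _ r x.
  rewrite normr_gt0 => /(_ rx) /nbhs_ballP[d /= d0 hd].
  have sgn y : `|x - y| < d -> 0 < r.[x] * r.[y].
    move=> xy; have /= := hd y xy.
    have [rx0|rx0] := ltrP 0 r.[x].
      by rewrite (gtr0_norm rx0) ltr_norml => /andP[]; nra.
    have rx1 : r.[x] < 0 by rewrite lt_neqAle rx.
    by rewrite (ltr0_norm rx1) ltr_norml => /andP[]; nra.
  exists (Num.min e (d / 2)).
  set h := Num.min _ _.
  have h0 : 0 < h by rewrite lt_min e0 divr_gt0.
  have hd2 : h <= d / 2 by rewrite ge_min lexx orbT.
  split=> //; first by rewrite ge_min lexx.
  have s1 : 0 < r.[x] * r.[x + h].
    by apply: sgn; rewrite opprD addNKr normrN gtr0_norm//; lra.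
  have s2 : 0 < r.[x] * r.[x - h].
    by apply: sgn; rewrite opprB addrC subrK gtr0_norm//; lra.
  have : 0 < r.[x] ^+ 2 by rewrite exprn_even_gt0//= rx.
  by have := mulr_gt0 s1 s2; nra.
have pp : p.[x + h] * p.[x - h] < 0.
  rewrite pe !hornerE /=; move: hr; set u := r.[_]; set v := r.[_] => hr.
  by have hh : 0 < h * h := mulr_gt0 h0 h0; nra.
have c1 : (P n).[x + h] @[n --> \oo] --> p.[x + h].
  by apply: (germ_poly_cvg gS hp); exact: cvg_cst.
have c2 : (P n).[x - h] @[n --> \oo] --> p.[x - h].
  by apply: (germ_poly_cvg gS hp); exact: cvg_cst.
have c12 : (P n).[x + h] * (P n).[x - h] @[n --> \oo] --> p.[x + h] * p.[x - h].
  exact: cvgM.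
near=> n.
have : (P n).[x + h] * (P n).[x - h] < 0.
  by near: n; exact: (cvgr_lt _ c12).
move=> hn; have xh : x - h <= x + h by lra.
have [s0|s0] := ltrP (P n).[x - h] 0.
  have [|y yI ry] := poly_ivt xh (p := P n).
    by rewrite (ltW s0)/=; nra.
  by exists y => //; move: yI; rewrite ler_norml; lra.
have [|y yI ry] := poly_ivt xh (p := - P n).
  by rewrite !hornerN oppr_le0 s0 oppr_ge0 /=; nra.
exists y; first by rewrite rootN in ry.
by move: yI; rewrite ler_norml; lra.
Unshelve. all: by end_near. Qed.

(** [root_near] treats each [e] separately. Picking a root of [P n] nearest to [x] up to
    [1 / (n + 1)] gives one sequence that works for every [e]; the value [x] is a placeholder for
    the finitely many [n] without a root. *)
Lemma root_sequence S m p P x : germs S -> germ_poly S m p P -> p.[x] = 0 ->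
  p^`().[x] != 0 ->
  exists2 X : nat -> R, X @ \oo --> x & \forall n \near \oo, (P n).[X n] = 0.
Proof.
move=> gS hp px p'x; have hr := root_near gS hp px p'x.
have step n : exists y, (exists z, root (P n) z) -> root (P n) y /\
    forall z, root (P n) z -> `|y - x| <= `|z - x| + n.+1%:R^-1.
  have [hz|hz] := pselect (exists z, root (P n) z); last by exists x.
  pose E := [set `|z - x| | z in [set z | root (P n) z]].
  have hE : has_inf E.
    by case: hz => z rz; split; [exists `|z - x|, z|exists 0 => _ [w _ <-]].
  have e0 : 0 < n.+1%:R^-1 :> R by rewrite invr_gt0.
  have [_ [y ry <-] hy] := inf_adherent e0 hE.
  exists y => _; split=> // z rz; apply: ltW; apply: lt_le_trans hy _.
  by rewrite lerD2r; apply: ge_inf; [case: hE|exists z].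
have [X hX] := choice step; exists X.
  apply/cvgrPdist_le => e e0; have e1 : 0 < e / 2 by lra.
  have inv0 : \forall n \near \oo, n.+1%:R^-1 < e / 2 :> R.
    exact: near_infty_natSinv_lt (PosNum e1).
  near=> n.
  have [y ry hy] : exists2 y, root (P n) y & `|y - x| <= e / 2 by near: n; exact: hr.
  have [_ /(_ _ ry)] := hX n (ex_intro _ y ry).
  have : n.+1%:R^-1 < e / 2 :> R by near: n.
  by rewrite distrC => i1 h; rewrite (le_trans h)// (splitr e) lerD// ltW.
near=> n; have [y ry _] : exists2 y, root (P n) y & `|y - x| <= 1 by near: n; exact: hr.
by have [/rootP] := hX n (ex_intro _ y ry).
Unshelve. all: by end_near. Qed.

(** Minimality of [p] makes [x] a simple root, so [X] can follow a root of the deformed polynomial.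
    Any other relation at [x] is reduced by pseudo-division by [p], carried out on the deformations
    in parallel. *)
Lemma germs_ext_algebraic S m p P x : germs S -> germ_poly S m p P ->
  p != 0 -> p.[x] = 0 ->
  (forall k q Q, germ_poly S k q Q -> q.[x] = 0 -> q != 0 -> (size p <= size q)%N) ->
  exists2 X : nat -> R, X @ \oo --> x & germs (germ_ext S x X).
Proof.
move=> gS [h1 h2 h3] p0 px min.
pose s := size p.
have s1 : (1 < s)%N.
  rewrite ltnNge; apply/negP => /size1_polyC pc; move: p0 px.
  by rewrite pc hornerC polyC_eq0 => /eqP.
(* Truncation makes the size of [p] itself a bound for the deformed polynomials, so that coefficient
   [s.-1] plays the role of a leading coefficient for each of them. *)
pose P' n := \poly_(i < s) (P n)`_i.
have hP : germ_poly S s p P'.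
  split=> // [n|i]; first exact: size_poly.
  under [fun n => _]funext do rewrite coef_poly.
  by case: ltnP => // si; rewrite nth_default//; exact: germs0.
have p'x : p^`().[x] != 0.
  apply/eqP => dx.
  have hd : germ_poly S s p^`() (fun n => (P' n)^`()).
    case: hP => k1 k2 k3; split.
    - exact/ltnW/lt_size_deriv.
    - move=> n; apply/leq_sizeP => i si.
      by rewrite coef_deriv nth_default ?mul0rn// (leq_trans (k2 n))// leqW.
    - move=> i; rewrite coef_deriv -mulr_natr.
      under [fun n => _]funext do rewrite coef_deriv -mulr_natr.
      by apply: germsM => //; exact: (germs_int i.+1 gS).
  have : p^`() != 0.
    have [s' es] : exists s', size p = s'.+2.
      by move: s1; rewrite /s; case: (size p) => [|[|s']]// _; exists s'.
    apply/eqP => /polyP/(_ s'); rewrite coef_deriv coef0 => /eqP.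
    by rewrite mulrn_eq0 /= -[s'.+1]/(s'.+2.-1) -es -lead_coefE lead_coef_eq0 (negbTE p0).
  move=> /(min _ _ _ hd dx); rewrite leqNgt lt_size_deriv//.
have [X Xx hX] := root_sequence gS hP px p'x.
exists X => //; apply: germs_ext => // k.
(* The induction is on the common size bound, because [Q n] may be larger than [q]. *)
elim: k => [|k IHk] q Q hq qx.
  near=> n; have [_ /(_ n)] := hq.
  by rewrite leqn0 size_poly_eq0 => /eqP -> _; rewrite horner0.
have [q0|q0] := eqVneq q 0.
  near=> n; have -> : Q n = 0 by near: n; rewrite q0 in hq; exact: germ_poly0P hq.
  by rewrite horner0.
have sq := min _ _ _ hq qx q0.
have [q1 q2 q3] := hq; have [k1 k2 k3] := hP.
have sk : (s.-1 <= k)%N by rewrite -ltnS prednK ?(ltnW s1)// (leq_trans sq).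
pose j := (k - s.-1)%N.
pose q' := p`_s.-1 *: q - q`_k *: ('X^j * p).
pose Q' n := (P' n)`_s.-1 *: Q n - (Q n)`_k *: ('X^j * P' n).
have cf (a b : {poly R}) i : (size a <= s)%N -> (size b <= k.+1)%N ->
    (k <= i)%N -> (a`_s.-1 *: b - b`_k *: ('X^j * a))`_i = 0.
  move=> sa sb ki; rewrite coefB !coefZ coefXnM.
  have -> : (i < j)%N = false by apply/negbTE; rewrite -leqNgt (leq_trans (leq_subr _ _)).
  have [->|ik] := eqVneq i k; first by rewrite subKn// mulrC subrr.
  have {}ki : (k < i)%N by rewrite ltn_neqAle eq_sym ik.
  rewrite (nth_default _ (leq_trans sb ki)) [a`_(i - j)]nth_default ?mulr0 ?subr0//.
  by apply: (leq_trans sa); move: s1 sk ki; rewrite /j; lia.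
have hq' : germ_poly S k q' Q'.
  split; first by apply/leq_sizeP => i; exact: cf.
    by move=> n; apply/leq_sizeP => i; exact: cf.
  move=> i; rewrite coefB !coefZ coefXnM.
  under [fun n => _]funext do rewrite coefB !coefZ coefXnM.
  apply: germsB => //; first exact: germsM.
  by apply: germsM => //; case: ltnP => // _; exact: germs0.
have q'x : q'.[x] = 0 by rewrite !hornerE /= qx px !mulr0 subrr.
have hQ' := IHk _ _ hq' q'x.
have c0 : \forall n \near \oo, (P' n)`_s.-1 != 0.
  by apply: (germs_neq0 gS (k3 s.-1)); rewrite -lead_coefE lead_coef_eq0.
near=> n.
have Pn : (P' n).[X n] = 0 by near: n.
have : (Q' n).[X n] = 0 by near: n.
rewrite !hornerE /= Pn !mulr0 subr0 => /eqP; rewrite mulf_eq0 => /orP[|/eqP//].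
by apply: contraTeq => _; near: n.
Unshelve. all: by end_near. Qed.

(** A number transcendental over [S] may stay fixed; an algebraic one must follow a root of a
    relation of least size. *)
Lemma germs_extend S x : germs S ->
  exists S' (X : nat -> R), [/\ germs S', S' x X & forall a f, S a f -> S' a f].
Proof.
move=> gS.
suff [X gX] : exists X, germs (germ_ext S x X).
  exists (germ_ext S x X), X; split=> //; first exact: germ_ext_gen.
  by move=> a f; exact: germ_extW.
pose alg s := exists m p P, [/\ germ_poly S m p P, p != 0, p.[x] = 0 & size p = s].
have [h|h] := pselect (exists s, alg s); last first.
  exists (fun=> x); apply: germs_ext_transcendental => //; first exact: cvg_cst.
  move=> m p P hp px; apply: contrapT => /eqP p0; apply: h.
  by exists (size p), m, p, P.
have [s hs] : exists s, `[< alg s >] by case: h => s hs; exists s; apply/asboolP.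
case: (ex_minnP (ex_intro (fun s => `[< alg s >]) s hs)) => {h hs}s.
move=> /asboolP[m [p [P [hp p0 px sp]]]] min.
have [|X _ gX] := germs_ext_algebraic gS hp p0 px; last by exists X.
move=> k q Q hq qx q0; rewrite sp; apply: min; apply/asboolP.
by exists k, q, Q.
Qed.

(** Over the constant rational germs [t] satisfies no relation, so it may be moved first; the
    numbers [v i] are then adjoined one by one and follow it. *)
Lemma germs_deformation (t : R) : ~ algebraicOver (ratr : rat -> R) t ->
  forall (I : finType) (v : I -> R), exists S (X : I -> nat -> R),
    [/\ germs S, S t (fun n => t + n.+1%:R^-1) & forall i, S (v i) (X i)].
Proof.
move=> nt I v.
pose S0 (a : R) (f : nat -> R) := exists q : rat, a = ratr q /\ f = (fun=> a).
have gS0 : germs S0.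
  split.
  - by move=> q; exists q.
  - by move=> a b f g [q [-> ->]] [r [-> ->]]; exists (q + r); rewrite rmorphD.
  - by move=> a b f g [q [-> ->]] [r [-> ->]]; exists (q * r); rewrite rmorphM.
  - by move=> a f [q [-> ->]]; exact: cvg_cst.
  - by move=> f [q [_ ->]]; near=> n.
have cv : t + n.+1%:R^-1 @[n --> \oo] --> t.
  rewrite -[X in _ --> X]addr0; apply: cvgD; first exact: cvg_cst.
  exact: cvg_harmonic.
have gS1 : germs (germ_ext S0 t (fun n => t + n.+1%:R^-1)).
  apply: germs_ext_transcendental => // m p P [_ _ hp] pt.
  apply: contrapT => /eqP p0; apply: nt.
  have [q hq] := choice (fun i => hp i).
  have pq : p = map_poly ratr (\poly_(i < size p) q i).
    apply/polyP => i; rewrite coef_map coef_poly; case: ltnP => [_|si].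
      by case: (hq i).
    by rewrite nth_default// raddf0.
  exists (\poly_(i < size p) q i); last by rewrite -pq; apply/rootP.
  by apply: contra p0 => /eqP r0; rewrite pq r0 rmorph0.
have gen (s : seq I) : exists S, [/\ germs S, S t (fun n => t + n.+1%:R^-1) &
    forall i, i \in s -> exists X, S (v i) X].
  elim: s => [|i s [S [gS St hS]]].
    by exists (germ_ext S0 t (fun n => t + n.+1%:R^-1)); split=> //; exact: germ_ext_gen.
  have [S' [X [gS' SX SS']]] := germs_extend (v i) gS.
  exists S'; split=> //; first exact: SS'.
  move=> j; rewrite inE => /orP[/eqP ->|/hS[Y SY]]; first by exists X.
  by exists Y; exact: SS'.
have [S [gS St hS]] := gen (enum I).
have [|X hX] := choice (P := fun i X => S (v i) X).
  by move=> i; apply: hS; rewrite mem_enum.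
by exists S, X.
Unshelve. all: by end_near. Qed.

End Germs.

(** * Coercivity *)

Section Coercive.
Context {R : realType}.
Notation intm := (map_mx (intr : int -> R)).

(* Dirichlet's simultaneous approximation: some multiple [q x], with [q] at most
   [Q ^ d], is within [1 / Q] of a nonzero integer vector. *)
Lemma seminorm_coercive d (A lam : R) : 0 <= A -> 0 < lam ->
  exists (kap : R) (M : nat), 0 < kap /\ forall N : 'rV[R]_d -> R, seminorm N ->
    (forall (z : 'rV_d) (e : R), (forall i, `|z 0 i| <= e) -> N z <= A * e) ->
    (forall u : 'rV[int]_d, u != 0 -> (forall i, (`|u 0%R i| <= M)%N) -> lam <= N (intm u)) ->
  forall (x : 'rV_d) i, kap * `|x 0 i| <= N x.
Proof.
move=> A0 lam0.
(* Makes [A / Q], the cost of replacing [q * y] by an integer vector, at most [lam / 2]. The second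
   successor ensures [Q > 1], whence the integer vector is non-zero. *)
pose Q := (Num.truncn (2 * A / lam)).+2.
have Q0 : 0 < Q%:R :> R by [].
have QA : A * Q%:R^-1 <= lam / 2.
  have : 2 * A / lam < Q%:R.
    apply: lt_le_trans (truncnS_gt _) _; rewrite ler_nat.
    by rewrite /Q.
  rewrite ltr_pdivrMr// ler_pdivrMr// => /ltW; lra.
have Qd0 : 0 < (Q ^ d)%:R :> R by rewrite ltr0n expn_gt0.
(* From [lam <= N u <= q * N y + lam / 2] with [q <= Q ^ d]; the entries of [u] are within [1 / Q]
   of those of [q * y], hence at most [Q ^ d + 1]. *)
exists (lam / (2 * (Q ^ d)%:R)), (Q ^ d).+1; split.
  by rewrite divr_gt0// mulr_gt0.
move=> N sN NA Nlam x i.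
have [ND NZ] := sN.
pose i0 := [arg max_(j > i) `|x 0 j|]%O.
have hi0 j : `|x 0 j| <= `|x 0 i0|.
  by rewrite /i0; case: arg_maxP => // l _; apply.
apply: le_trans (_ : lam / (2 * (Q ^ d)%:R) * `|x 0 i0| <= _).
  by rewrite ler_wpM2l// ltW// divr_gt0// mulr_gt0.
have [x0|x0] := eqVneq (x 0 i0) 0; first by rewrite x0 normr0 mulr0 seminorm_ge0.
pose y := (x 0 i0)^-1 *: x.
have yi0 : y 0 i0 = 1 by rewrite mxE mulVf.
have y1 j : `|y 0 j| <= 1.
  by rewrite mxE normrM normfV ler_pdivrMl ?normr_gt0// mulr1.
suff hy : lam / (2 * (Q ^ d)%:R) <= N y.
  have -> : x = x 0 i0 *: y by rewrite scalerA mulfV// scale1r.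
  by rewrite NZ mxE yi0 mulr1 mulrC ler_wpM2l.
pose fl (j : nat) l := Num.floor (j%:R * y 0 l).
pose fr (j : nat) l : R := j%:R * y 0 l - (fl j l)%:~R.
have fr0 j l : 0 <= fr j l by have := floor_le_tmp (j%:R * y 0 l); rewrite /fr /fl; lra.
have fr1 j l : fr j l < 1 by have := floorD1_gt (j%:R * y 0 l); rewrite /fr /fl intrD; lra.
have cell j l : (Num.truncn (Q%:R * fr j l) < Q)%N.
  rewrite truncn_lt_nat; last by rewrite mulr_ge0.
  by rewrite -[ltRHS]mulr1 ltr_pM2l.
pose f (j : 'I_(Q ^ d).+1) := [ffun l : 'I_d => Ordinal (cell j l)].
have [j [j' [jj fj]]] : exists j j' : 'I_(Q ^ d).+1, (j < j')%N /\ f j = f j'.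
  apply: contrapT => h.
  have fi : injective f.
    move=> j j' fj; apply/val_inj; case: (ltngtP j j') => // jj; exfalso; apply: h.
      by exists j, j'.
    by exists j', j.
  by have := leq_card f fi; rewrite card_ord card_ffun !card_ord ltnn.
pose q := (j' - j)%N.
have qE : q%:R = j'%:R - j%:R :> R by rewrite natrB// ltnW.
pose u : 'rV[int]_d := \row_l (fl j' l - fl j l).
have uE l : q%:R * y 0 l - (u 0 l)%:~R = fr j' l - fr j l.
  by rewrite [u 0 l]mxE intrB qE /fr; ring.
have close l : `|q%:R * y 0 l - (u 0 l)%:~R| <= Q%:R^-1.
  rewrite uE; have /ffunP/(_ l) := fj; rewrite !ffunE => /(congr1 val) /= e.
  have h1 := truncn_itv (mulr_ge0 (ltW Q0) (fr0 j l)).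
  have h2 := truncn_itv (mulr_ge0 (ltW Q0) (fr0 j' l)).
  move: h1 h2; rewrite e => /andP[h1 h2] /andP[h3 h4].
  move: h2 h4; rewrite -[X in _ < X -> _ < X -> _]natr1 => h2 h4.
  by rewrite -div1r ler_pdivlMr// -[X in _ * X](gtr0_norm Q0) -normrM ler_norml; lra.
have q1 : 1 <= q%:R :> R by rewrite ler1n subn_gt0.
have qQ : (q <= Q ^ d)%N.
  by rewrite (leq_trans (leq_subr _ _))// -ltnS.
have Q2 : Q%:R^-1 < 1 :> R by rewrite invf_lt1// ltr1n.
have u0 : u != 0.
  apply/eqP => u0; have ui0 : u 0 i0 = 0 by rewrite u0 mxE.
  by have := close i0; rewrite ui0 subr0 yi0 mulr1 ger0_norm//; lra.
have uM l : (`|u 0%R l| <= (Q ^ d).+1)%N.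
  have : `|(u 0 l)%:~R : R| <= (Q ^ d).+1%:R.
    have := close l; have : q%:R * `|y 0 l| <= (Q ^ d)%:R.
      apply: le_trans (_ : q%:R * 1 <= _); first by rewrite ler_wpM2l.
      by rewrite mulr1 ler_nat.
    rewrite -[X in X * _](ger0_norm (ler0n _ _)) -normrM -[X in _ -> _ -> _ <= X]natr1.
    by rewrite !ler_norml; lra.
  by rewrite -intr_norm -abszE -pmulrn ler_nat.
have := Nlam u u0 uM.
have : N (intm u) <= N (q%:R *: y) + A * Q%:R^-1.
  have -> : intm u = q%:R *: y + (intm u - q%:R *: y) by rewrite addrC subrK.
  apply: le_trans (ND _ _) _; rewrite lerD2l; apply: NA => l.
  by rewrite !mxE distrC; have := close l; rewrite !mxE.
rewrite NZ ger0_norm// => h1 h2.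
rewrite ler_pdivrMr ?mulr_gt0//.
have : q%:R * N y <= (Q ^ d)%:R * N y.
  by rewrite ler_wpM2r ?ler_nat// seminorm_ge0.
lra.
Qed.

End Coercive.

(** * Configurations *)

Section Hull.
Context {R : realType}.

Definition simplex N : set 'rV[R]_N :=
  [set c | (forall i, 0 <= c 0 i) /\ \sum_i c 0 i = 1].

Lemma convex_body_simplex N : convex_body (@simplex N.+1).
Proof.
split.
- exists (delta_mx 0 0); split=> [i|]; first by rewrite mxE ler0n.
  by rewrite (bigD1 0)//= mxE !eqxx big1 ?addr0// => i i0; rewrite mxE (negbTE i0) andbF.
- apply: bounded_closed_compact.
    exists 1; split=> // M M1 c [c0 c1]; apply: norm_le_coord; first lra.
    move=> i; rewrite ger0_norm//; apply: le_trans (ltW M1).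
    by rewrite -c1 (bigD1 i)//= lerDl sumr_ge0.
  rewrite (_ : @simplex N.+1 =
      (\bigcap_(i in [set: 'I_N.+1]) [set c : 'rV[R]_N.+1 | 0 <= c 0 i])
      `&` [set c : 'rV[R]_N.+1 | dot c (const_mx 1) = 1]).
    apply: closedI.
      apply: closed_bigI => i _.
      apply: (@preimage_closed _ _ (fun c : 'rV[R]_N.+1 => c 0 i) [set r | 0 <= r]).
        by move=> c _; exact: coord_continuous.
      exact: closed_ge.
    apply: (@preimage_closed _ _ (fun c : 'rV[R]_N.+1 => dot c (const_mx 1)) [set r | r = 1]).
      move=> c _; apply: continuous_dot => i; first exact: coord_continuous.
      exact: cst_continuous.
    exact: closed_eq.
  have ds (c : 'rV[R]_N.+1) : dot c (const_mx 1) = \sum_i c 0 i.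
    by apply: eq_bigr => i _; rewrite mxE mulr1.
  apply/seteqP; split=> c /= [c0 c1].
    by split=> [i _|]; [exact: c0|rewrite ds].
  by split=> [i|]; [exact: c0|rewrite -ds].
- apply/convexP => x y t [x0 x1] [y0 y1] t0 t1; split=> [i|].
    by rewrite !mxE addr_ge0// mulr_ge0// subr_ge0.
  under eq_bigr do rewrite !mxE.
  by rewrite big_split -!mulr_sumr /= x1 y1; ring.
Qed.

(** As an affine image of the standard simplex, the hull inherits compactness and convexity. *)
Definition hull N m (P : 'M[R]_(N.+1, m)) : set 'rV[R]_m := aff P 0 (@simplex N.+1).

Lemma convex_body_hull N m (P : 'M[R]_(N.+1, m)) : convex_body (hull P).
Proof. exact/convex_body_aff/convex_body_simplex. Qed.

Lemma hull_row N m (P : 'M[R]_(N.+1, m)) i : hull P (row i P).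
Proof.
exists (delta_mx 0 i); last by rewrite addr0 -rowE.
split=> [j|]; first by rewrite mxE ler0n.
by rewrite (bigD1 i)//= mxE !eqxx big1 ?addr0// => j ji; rewrite mxE (negbTE ji) andbF.
Qed.

Lemma hull_le N m (P : 'M[R]_(N.+1, m)) a b : (forall i, dot a (row i P) <= b) ->
  forall x, hull P x -> dot a x <= b.
Proof.
move=> h _ [c [c0 c1] <-]; rewrite addr0 dot_mulmx dotC -[b]mul1r -c1 mulr_suml.
apply: ler_sum => i _; apply: ler_wpM2l => //; apply: le_trans (h i).
rewrite le_eqVlt; apply/orP; left; apply/eqP; rewrite mxE.
by apply: eq_bigr => j _; rewrite !mxE.
Qed.

End Hull.

Section LatticeBox.
Context {m D : nat}.

Definition lattice_box : finType := {ffun 'I_m -> 'I_(2 * D).+1}.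

Definition box_point (z : lattice_box) : 'rV[int]_m := \row_i ((z i : nat)%:Z - D%:Z).

Lemma box_point_inj : injective box_point.
Proof.
move=> y z /rowP h; apply/ffunP => i; apply/val_inj.
by have := h i; rewrite !mxE => /addIr [].
Qed.

Lemma box_point_surj (u : 'rV[int]_m) : (forall i, (`|u 0%R i| <= D)%N) ->
  exists z, box_point z = u.
Proof.
move=> hu; exists [ffun i => inord (absz (u 0%R i + D%:Z))].
apply/rowP => i; rewrite mxE ffunE inordK; have := hu i; lia.
Qed.

End LatticeBox.

Section Configurations.
Context {R : realType}.
Variables (n D M : nat).
Notation m := n.+1.
Notation intm := (map_mx (intr : int -> R)).
Let Z := @lattice_box m D.
Let U := @lattice_box m M.

(** One normal per lattice point, two points of the body per direction, and the width. The width is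
    a coordinate of its own, so that the deformation applies to it directly. *)
Definition coords : finType := (Z * 'I_m + (U * 'I_m + U * 'I_m) + unit)%type.

Implicit Types (v : coords -> R) (S : {set Z}).

Definition cfg_normal v (z : Z) : 'rV[R]_m := \row_i v (inl (inl (z, i))).
Definition cfg_max v (u : U) : 'rV[R]_m := \row_i v (inl (inr (inl (u, i)))).
Definition cfg_min v (u : U) : 'rV[R]_m := \row_i v (inl (inr (inr (u, i)))).
Definition cfg_width v : R := v (inr tt).

(* A configuration certifies that the hull of the points [cfg_max] and [cfg_min]
   has its interior lattice points in [S], by the normals of supporting
   hyperplanes at the other lattice points of the box, and has width at least
   [cfg_width] in the directions of [U]. *)
Definition config S v : Prop :=
  [/\ forall i, 0 <= D%:R - v i /\ 0 <= D%:R + v i,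
      forall z, z \notin S -> dot (cfg_normal v z) (cfg_normal v z) - 1 = 0,
      forall z u, z \notin S ->
        0 <= dot (cfg_normal v z) (intm (box_point z) - cfg_max v u) /\
        0 <= dot (cfg_normal v z) (intm (box_point z) - cfg_min v u) &
      forall u, box_point u != 0 ->
        0 <= dot (intm (box_point u)) (cfg_max v u - cfg_min v u) - cfg_width v].

Lemma config_of_body (k : nat) (K : set 'rV[R]_m) (t : R) : convex_body K ->
  (interior_lattice_points K #<= `I_k)%card ->
  (forall x, K x -> forall i, `|x 0 i| <= D%:R) -> (0 < D)%N ->
  0 <= t -> t <= D%:R -> (forall u, u != 0 -> t <= directional_width K u) ->
  exists S v, [/\ (#|S| <= k)%N, config S v & cfg_width v = t].
Proof.
move=> bK Kk KD D0 t0 tD Kt; have [K0 cK vK] := bK.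
pose S : {set Z} := finset (fun z => `[< interior K (intm (box_point z)) >]).
have hS : (#|S| <= k)%N.
  apply: (finset_card_le (f := box_point) _ _ Kk); first exact: box_point_inj.
  by move=> z; rewrite inE => /asboolP.
have normal (z : Z) : exists a : 'rV[R]_m, (forall i, `|a 0 i| <= 1) /\
    (z \notin S -> dot a a = 1 /\ forall x, K x -> dot a x <= dot a (intm (box_point z))).
  have [zS|zS] := boolP (z \in S).
    by exists 0; split=> // i; rewrite mxE normr0.
  have /(support K0 cK vK)[a a0 ha] : ~ interior K (intm (box_point z)).
    by move: zS; rewrite inE => /asboolP.
  have aa := dot_gt0 a0.
  (* The Euclidean length is normalised, not the sup norm, because [dot a a = 1] is a polynomial
     equation; it is also closed and excludes the zero normal. *)
  pose s := Num.sqrt (dot a a).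
  have s0 : 0 < s by rewrite sqrtr_gt0.
  have e1 : dot (s^-1 *: a) (s^-1 *: a) = 1.
    rewrite dotZl dotZr mulrA -invfM -expr2 sqr_sqrtr ?(ltW aa)//.
    by rewrite mulVf// gt_eqF.
  exists (s^-1 *: a); split; last first.
    by split=> // x Kx; rewrite !dotZl ler_wpM2l ?invr_ge0 ?(ltW s0)// ha.
  move=> i; set b := s^-1 *: a in e1 *.
  have bi : b 0 i * b 0 i <= 1.
    by rewrite -e1 /dot (bigD1 i)//= lerDl sumr_ge0// => j _; rewrite -expr2 sqr_ge0.
  by rewrite ler_norml; nra.
have [a_ ha] := choice normal.
have width (u : U) : exists p : 'rV[R]_m * 'rV[R]_m, [/\ K p.1, K p.2 &
    directional_width K (box_point u) = dot (intm (box_point u)) (p.1 - p.2)].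
  have [x [y [Kx Ky h]]] := rwidth_attained (intm (box_point u)) bK.
  by exists (x, y); split=> //; rewrite directional_widthE h dotBr.
have [p_ hp] := choice width.
have D1 : 1 <= D%:R :> R by rewrite ler1n.
pose v (c : coords) : R := match c with
  | inl (inl (z, i)) => a_ z 0 i
  | inl (inr (inl (u, i))) => (p_ u).1 0 i
  | inl (inr (inr (u, i))) => (p_ u).2 0 i
  | inr _ => t end.
have vn z : cfg_normal v z = a_ z by apply/rowP => i; rewrite mxE.
have vx u : cfg_max v u = (p_ u).1 by apply/rowP => i; rewrite mxE.
have vy u : cfg_min v u = (p_ u).2 by apply/rowP => i; rewrite mxE.
exists S, v; split=> //; split.
- move=> i; suff : `|v i| <= D%:R by rewrite ler_norml; lra.
  case: i => [[[z i]|[[u i]|[u i]]]|[]] /=.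
  + exact: le_trans ((ha z).1 i) D1.
  + by apply: KD; case: (hp u).
  + by apply: KD; case: (hp u).
  + by rewrite ger0_norm.
- by move=> z zS; rewrite vn; have [-> _] := (ha z).2 zS; rewrite subrr.
- move=> z u zS; rewrite vn vx vy !dotBr !subr_ge0.
  by have [_ h] := (ha z).2 zS; have [K1 K2 _] := hp u; split; exact: h.
- move=> u u0; rewrite vx vy subr_ge0 /cfg_width /=.
  by have [_ _ <-] := hp u; exact: Kt.
Qed.

(** A lattice point outside [S] cannot be interior to the hull, since its unit normal would have to
    vanish. Only directions bounded by [M] are controlled; the others are left to
    [seminorm_coercive]. *)
Lemma body_of_config (k : nat) S v : (#|S| <= k)%N -> config S v ->
  exists K : set 'rV[R]_m, [/\ convex_body K, (interior_lattice_points K #<= `I_k)%card,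
    forall x, K x -> forall i, `|x 0 i| <= D%:R &
    forall u : 'rV[int]_m, u != 0 -> (forall i, (`|u 0%R i| <= M)%N) ->
      cfg_width v <= directional_width K u].
Proof.
move=> Sk [v1 v2 v3 v4].
pose J : finType := (U + U)%type.
have [u0 _] : exists u : U, box_point u = 0.
  by apply: box_point_surj => i; rewrite mxE.
have [N cJ] : exists N, #|{: J}| = N.+1.
  by exists #|{: J}|.-1; rewrite prednK//; apply/card_gt0P; exists (inl u0).
pose pt (j : J) := match j with inl u => cfg_max v u | inr u => cfg_min v u end.
pose P : 'M[R]_(N.+1, m) := \matrix_i pt (enum_val (cast_ord (esym cJ) i)).
have ptP j : hull P (pt j).
  have -> : pt j = row (cast_ord cJ (enum_rank j)) P.
    by rewrite rowK cast_ordK enum_rankK.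
  exact: hull_row.
have Ple a b : (forall j, dot a (pt j) <= b) -> forall x, hull P x -> dot a x <= b.
  by move=> h; apply: hull_le => i; rewrite rowK.
have bP : convex_body (hull P) by exact: convex_body_hull.
have vD c : `|v c| <= D%:R by have [] := v1 c; rewrite ler_norml; lra.
have di i (x : 'rV[R]_m) : dot (delta_mx 0 i) x = x 0 i.
  rewrite dotC /dot (bigD1 i)//= mxE !eqxx mulr1 big1 ?addr0// => j ji.
  by rewrite mxE (negbTE ji) andbF mulr0.
have PD x : hull P x -> forall i, `|x 0 i| <= D%:R.
  move=> Px i; rewrite ler_norml -lerNl -di -dotNl di; apply/andP; split.
    apply: (Ple _ _ _ _ Px) => j; rewrite dotNl di.
    by apply: le_trans (ler_norm _) _; rewrite normrN; case: j => u; rewrite mxE.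
  rewrite -di; apply: (Ple _ _ _ _ Px) => j; rewrite di.
  by apply: le_trans (ler_norm _) _; case: j => u; rewrite mxE.
exists (hull P); split=> //.
- apply: (card_le_finset (f := box_point)) Sk _ => w hw.
  have /= Pw := interior_subset hw.
  have [z zw] : exists z : Z, box_point z = w.
    apply: box_point_surj => i; have := PD _ Pw i.
    by rewrite mxE -intr_norm -abszE -pmulrn ler_nat.
  exists z => //=; apply: contrapT => /negP zS.
  have : cfg_normal v z = 0.
    apply: (interior_support hw) => x; apply: Ple => j; rewrite -zw.
    by have [h1 h2] := v3 z (match j with inl u => u | inr u => u end) zS;
      case: j h1 h2 => u; rewrite !dotBr !subr_ge0.
  move=> az; have := v2 z zS; rewrite az -(scale0r 0) dotZl mul0r; lra.
- move=> w w0 wM; have [u uw] := box_point_surj wM.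
  rewrite -uw in w0 *; have := v4 u w0; rewrite subr_ge0 => h; apply: le_trans h _.
  rewrite directional_widthE dotBr; apply: rwidth_ge => //.
    exact: (ptP (inl u)).
  exact: (ptP (inr u)).
Qed.

Lemma config_deform S v : ~ algebraicOver (ratr : rat -> R) (cfg_width v) ->
  config S v -> exists2 v', config S v' & cfg_width v < cfg_width v'.
Proof.
move=> na [v1 v2 v3 v4].
have [G [X [gG Gt GX]]] := germs_deformation na v.
pose w (j : nat) (c : coords) := X c j.
have Gdot (a b : 'rV[R]_m) (f g : nat -> 'rV[R]_m) :
    (forall i, G (a 0 i) (fun j => f j 0 i)) -> (forall i, G (b 0 i) (fun j => g j 0 i)) ->
    G (dot a b) (fun j => dot (f j) (g j)).
  by move=> ha hb; apply: germs_sum => // i; exact: germsM.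
have GN z i : G (cfg_normal v z 0 i) (fun j => cfg_normal (w j) z 0 i).
  by rewrite mxE; under [X in G _ X]funext do rewrite mxE; exact: GX.
have Gx u i : G (cfg_max v u 0 i) (fun j => cfg_max (w j) u 0 i).
  by rewrite mxE; under [X in G _ X]funext do rewrite mxE; exact: GX.
have Gy u i : G (cfg_min v u 0 i) (fun j => cfg_min (w j) u 0 i).
  by rewrite mxE; under [X in G _ X]funext do rewrite mxE; exact: GX.
have Gi (z : 'rV[int]_m) i : G (intm z 0 i) (fun=> intm z 0 i).
  by rewrite mxE; exact: germs_int.
have GB (a b : 'rV[R]_m) (f g : nat -> 'rV[R]_m) i :
    G (a 0 i) (fun j => f j 0 i) -> G (b 0 i) (fun j => g j 0 i) ->
    G ((a - b) 0 i) (fun j => (f j - g j) 0 i).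
  rewrite mxE [X in _ + X]mxE => ha hb.
  by under [X in G _ X]funext do rewrite mxE [X in _ + X]mxE; exact: germsB.
have GD : G D%:R (fun=> D%:R) by exact: (germs_int D gG).
have w1 : \forall j \near \oo, forall c, 0 <= D%:R - w j c /\ 0 <= D%:R + w j c.
  apply: filter_forall => c; have [h1 h2] := v1 c; near=> j; split; near: j.
    by apply: (germs_ge0 gG (germsB gG GD (GX c))).
  by apply: (germs_ge0 gG (germsD gG GD (GX c))).
have w2 : \forall j \near \oo, forall z, z \notin S ->
    dot (cfg_normal (w j) z) (cfg_normal (w j) z) - 1 = 0.
  apply: filter_forall => z; have [zS|zS] := boolP (z \in S); first by near=> j.
  have h := germsB gG (Gdot _ _ _ _ (GN z) (GN z)) (germs_int 1 gG).
  rewrite v2// in h.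
  by near=> j => _; near: j; exact: germs0P h.
have w3 : \forall j \near \oo, forall z u, z \notin S ->
    0 <= dot (cfg_normal (w j) z) (intm (box_point z) - cfg_max (w j) u) /\
    0 <= dot (cfg_normal (w j) z) (intm (box_point z) - cfg_min (w j) u).
  apply: filter_forall => z; apply: filter_forall => u.
  have [zS|zS] := boolP (z \in S); first by near=> j.
  have [h1 h2] := v3 z u zS.
  have g1 := Gdot _ _ _ _ (GN z) (fun i => GB _ _ _ _ i (Gi (box_point z) i) (Gx u i)).
  have g2 := Gdot _ _ _ _ (GN z) (fun i => GB _ _ _ _ i (Gi (box_point z) i) (Gy u i)).
  by near=> j => _; split; near: j; [exact: germs_ge0 g1 h1|exact: germs_ge0 g2 h2].
have w4 : \forall j \near \oo, forall u, box_point u != 0 ->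
    0 <= dot (intm (box_point u)) (cfg_max (w j) u - cfg_min (w j) u) - cfg_width (w j).
  apply: filter_forall => u.
  have [u0|u0] := boolP (box_point u != 0); last by near=> j.
  have g := germsB gG (Gdot _ _ _ _ (Gi (box_point u))
    (fun i => GB _ _ _ _ i (Gx u i) (Gy u i))) (GX (inr tt)).
  by near=> j => _; near: j; exact: germs_ge0 g (v4 u u0).
have w5 : \forall j \near \oo, cfg_width v < cfg_width (w j).
  (* The width is deformed twice, as a coordinate through [GX] and as [t + 1 / (n + 1)] through
     [Gt]. The zero clause forces the two to agree eventually, so the coordinate does increase. *)
  have := germsB gG (GX (inr tt)) Gt; rewrite subrr => /(germs0P gG) h.
  near=> j; have : cfg_width (w j) - (cfg_width v + j.+1%:R^-1) = 0 by near: j.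
  by move=> /eqP; rewrite subr_eq0 => /eqP ->; rewrite ltrDl invr_gt0.
have [j [[[[h1 h2] h3] h4] h5]] :=
  filter_ex (filterI (filterI (filterI (filterI w1 w2) w3) w4) w5).
by exists (w j).
Unshelve. all: by end_near. Qed.

Definition cfg_of_row (w : 'rV[R]_#|coords|) (c : coords) : R := w 0 (enum_rank c).

Lemma closed_forall (T : topologicalType) (I : Type) (A : I -> set T) :
  (forall i, closed (A i)) -> closed [set t | forall i, A i t].
Proof.
move=> cA; rewrite (_ : mkset _ = \bigcap_(i in [set: I]) A i).
  by apply: closed_bigI => i _; exact: cA.
by apply/seteqP; split=> t /= h i; [move=> _|]; exact: h.
Qed.

Lemma closed_ge0 (T : topologicalType) (g : T -> R) :
  continuous g -> closed [set t | 0 <= g t].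
Proof.
move=> cg; apply: (@preimage_closed _ _ g [set r | 0 <= r]); last exact: closed_ge.
by move=> t _; exact: cg.
Qed.

Lemma compact_config S : compact [set w | config S (cfg_of_row w)].
Proof.
apply: bounded_closed_compact.
  exists D%:R; split=> // B DB w [h _ _ _]; apply: norm_le_coord.
    by apply: le_trans (ltW DB).
  move=> i; apply: le_trans (ltW DB); have := h (enum_val i).
  by rewrite /cfg_of_row enum_valK ler_norml; lra.
have cv c : continuous (cfg_of_row ^~ c) by exact: coord_continuous.
have cN z i : continuous (fun w => cfg_normal (cfg_of_row w) z 0 i).
  by under [X in continuous X]funext do rewrite mxE; exact: cv.
have cx u i : continuous (fun w => cfg_max (cfg_of_row w) u 0 i).
  by under [X in continuous X]funext do rewrite mxE; exact: cv.
have cy u i : continuous (fun w => cfg_min (cfg_of_row w) u 0 i).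
  by under [X in continuous X]funext do rewrite mxE; exact: cv.
have cB (a b : 'rV[R]_#|coords| -> 'rV[R]_m) i : continuous (fun w => a w 0 i) ->
    continuous (fun w => b w 0 i) -> continuous (fun w => (a w - b w) 0 i).
  move=> ca cb; under [X in continuous X]funext do rewrite mxE [X in _ + X]mxE.
  by move=> w; apply: (cvgB (F := nbhs w)); [exact: ca|exact: cb].
have -> : [set w | config S (cfg_of_row w)] =
    [set w | forall c, 0 <= D%:R - cfg_of_row w c] `&`
    [set w | forall c, 0 <= D%:R + cfg_of_row w c] `&`
    [set w | forall z, z \notin S ->
       dot (cfg_normal (cfg_of_row w) z) (cfg_normal (cfg_of_row w) z) = 1] `&`
    [set w | forall z u, z \notin S -> 0 <= dot (cfg_normal (cfg_of_row w) z)
       (intm (box_point z) - cfg_max (cfg_of_row w) u)] `&`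
    [set w | forall z u, z \notin S -> 0 <= dot (cfg_normal (cfg_of_row w) z)
       (intm (box_point z) - cfg_min (cfg_of_row w) u)] `&`
    [set w | forall u, box_point u != 0 -> 0 <= dot (intm (box_point u))
       (cfg_max (cfg_of_row w) u - cfg_min (cfg_of_row w) u) - cfg_width (cfg_of_row w)].
  apply/seteqP; split=> w /=.
    move=> [h1 h2 h3 h4]; do !split=> //.
    - by move=> c; case: (h1 c).
    - by move=> c; case: (h1 c).
    - by move=> z /h2 /eqP; rewrite subr_eq0 => /eqP.
    - by move=> z u /(h3 z u)[].
    - by move=> z u /(h3 z u)[].
  move=> [[[[[h1 h2] h3] h4] h5] h6]; split=> //.
  - by move=> z /h3 ->; rewrite subrr.
  - by move=> z u zS; split; [exact: h4|exact: h5].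
repeat apply: closedI.
- apply: closed_forall => c; apply: closed_ge0 => w.
  by apply: (cvgB (F := nbhs w)); [exact: cvg_cst|exact: cv].
- apply: closed_forall => c; apply: closed_ge0 => w.
  by apply: (cvgD (F := nbhs w)); [exact: cvg_cst|exact: cv].
- apply: closed_forall => z; apply: closed_forall => _.
  apply: (@preimage_closed _ _ (fun w => dot (cfg_normal (cfg_of_row w) z)
    (cfg_normal (cfg_of_row w) z)) [set r | r = 1]); last exact: closed_eq.
  by move=> w _; exact: continuous_dot.
- apply: closed_forall => z; apply: closed_forall => u; apply: closed_forall => _.
  apply: closed_ge0; apply: continuous_dot => // i; apply: cB => //.
  exact: cst_continuous.
- apply: closed_forall => z; apply: closed_forall => u; apply: closed_forall => _.
  apply: closed_ge0; apply: continuous_dot => // i; apply: cB => //.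
  exact: cst_continuous.
- apply: closed_forall => u; apply: closed_forall => _; apply: closed_ge0 => w.
  apply: (cvgB (F := nbhs w)); last exact: cv.
  have cd : continuous (fun w => dot (intm (box_point u))
      (cfg_max (cfg_of_row w) u - cfg_min (cfg_of_row w) u)).
    apply: continuous_dot => i; first exact: cst_continuous.
    exact: cB.
  exact: cd.
Qed.

(** Each [S] poses a compact problem, and there are finitely many [S]; those without configurations
    are discarded before the maxima are compared. *)
Lemma config_max (k : nat) : (exists S v, (#|S| <= k)%N /\ config S v) ->
  exists S v, [/\ (#|S| <= k)%N, config S v &
    forall S' v', (#|S'| <= k)%N -> config S' v' -> cfg_width v' <= cfg_width v].
Proof.
move=> [S0 [v0 [S0k cS0]]].
have rowK v : cfg_of_row (\row_j v (enum_val j)) = v.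
  by apply/funext => c; rewrite /cfg_of_row mxE enum_rankK.
have best S : exists v, (exists v', config S v') -> config S v /\
    forall v', config S v' -> cfg_width v' <= cfg_width v.
  have [[v hv]|h] := pselect (exists v', config S v'); last by exists v0.
  have ne : [set w | config S (cfg_of_row w)] !=set0.
    by exists (\row_j v (enum_val j)); rewrite /= rowK.
  have [|w /set_mem hw hmax] := compact_EVT_max ne (@compact_config S)
      (f := fun w => cfg_width (cfg_of_row w)).
    by apply: continuous_subspaceT; exact: coord_continuous.
  exists (cfg_of_row w) => _; split=> // v' hv'.
  by rewrite -[v']rowK; apply: hmax; rewrite inE /= rowK.
have [b hb] := choice best.
pose P S := (#|S| <= k)%N && `[< exists v, config S v >].
have PS0 : P S0 by rewrite /P S0k; apply/asboolP; exists v0.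
have := @arg_maxP _ _ _ S0 P (fun S => cfg_width (b S)) PS0.
case=> S /andP[Sk /asboolP eS] Smax; have [cS Sb] := hb S eS.
exists S, (b S); split=> // S' v' S'k cS'.
have eS' : exists v, config S' v by exists v'.
apply: le_trans ((hb S' eS').2 _ cS') _.
by apply: Smax; rewrite /P S'k; exact/asboolP.
Qed.

End Configurations.

(** * The flatness constant *)

Section Main.
Context {R : realType}.
Notation intm := (map_mx (intr : int -> R)).

Definition admissible d k (K : set 'rV[R]_d) : Prop :=
  convex_body K /\ (interior_lattice_points K #<= `I_k)%card.

Lemma card_set0_le d (K : set 'rV[R]_d) k : interior_lattice_points K = set0 ->
  (interior_lattice_points K #<= `I_k)%card.
Proof. by move=> ->; exact: card_ge0. Qed.

Lemma origin_lattice_free n : convex_body [set (0 : 'rV[R]_n.+1)] /\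
  interior_lattice_points [set (0 : 'rV[R]_n.+1)] = set0.
Proof.
split.
  split; [by exists 0|exact: compact_set1|].
  by apply/convexP => x y t -> ->; rewrite !scaler0 addr0.
apply/seteqP; split=> // z iz; have /= z0 := interior_subset iz.
have /rowP/(_ 0) : delta_mx 0 0 = 0 :> 'rV[R]_n.+1.
  by apply: (interior_support iz) => x ->; rewrite z0.
by rewrite !mxE !eqxx => /eqP; rewrite oner_eq0.
Qed.

Section Cylinder.
Context {n : nat}.
Variables (K : set 'rV[R]_n) (T : R).
Hypotheses (bK : convex_body K) (T0 : 0 <= T).

Definition cylinder : set 'rV[R]_n.+1 :=
  [set insert_coord 0 p.2 p.1 | p in K `*` `[0, T]%classic].

Lemma convex_body_cylinder : convex_body cylinder.
Proof.
have [[x Kx] cK /convexP vK] := bK; split.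
- by exists (insert_coord 0 0 x), (x, 0) => //; split=> //=; rewrite in_itv /= lexx.
- apply: continuous_compact; last by apply: compact_setX => //; exact: segment_compact.
  apply: continuous_subspaceT; apply: continuous_rowP => i p.
  have [j ->|->] := unliftP 0 i.
    under [X in continuous_at _ X]funext do rewrite insert_coord_lift.
    have c1 : continuous (fun v : 'rV[R]_n => v 0 j) by exact: coord_continuous.
    apply: (@continuous_comp _ _ _ fst (fun v : 'rV[R]_n => v 0 j) p); last exact: c1.
    exact: cvg_fst.
  under [X in continuous_at _ X]funext do rewrite insert_coordE.
  exact: cvg_snd.
- apply/convexP => _ _ t [[x1 s1] [/= Kx1 s1I] <-] [[x2 s2] [/= Kx2 s2I] <-] t0 t1.
  exists (t *: x1 + (1 - t) *: x2, t * s1 + (1 - t) * s2).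
    split=> /=; first exact: vK.
    move: s1I s2I; rewrite !in_itv /= => /andP[? ?] /andP[? ?].
    by apply/andP; split; nra.
  by apply/rowP => i; rewrite !mxE; case: (unlift 0 i) => [j|] /=; rewrite ?mxE.
Qed.

Lemma dot_insert (a x : 'rV[R]_n) (r s : R) :
  dot (insert_coord 0 r a) (insert_coord 0 s x) = r * s + dot a x :> R.
Proof. by rewrite (dot_lift 0) !insert_coordE !insert_coord_drop. Qed.

Lemma cylinder_lattice_free : interior_lattice_points K = set0 ->
  interior_lattice_points cylinder = set0.
Proof.
move=> K0; have [nK cK vK] := bK; apply/seteqP; split=> // z iz.
suff : interior_lattice_points K (z *m drop_mx 0 int) by rewrite K0.
rewrite /interior_lattice_points /= map_mxM map_drop_mx.
apply: contrapT => /(support nK cK vK)[a a0 ha]; move/eqP: a0; apply.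
have a1 : insert_coord 0 0 a = 0.
  apply: (interior_support iz) => _ [[x s] [/= Kx _] <-].
  rewrite dot_insert (dot_lift 0) insert_coordE insert_coord_drop !mul0r !add0r.
  exact: ha.
by rewrite -(insert_coord_drop 0 0 a) a1 mul0mx.
Qed.

(** A direction with non-zero part along the base is at least as wide as the base in that part; a
    vertical one sees a non-zero integer multiple of the height [T]. *)
Lemma cylinder_width u : u != 0 -> (forall c, c != 0 -> T <= directional_width K c) ->
  T <= directional_width cylinder u.
Proof.
move=> u0 hT; have bC := convex_body_cylinder; rewrite directional_widthE.
have [[x Kx] _ _] := bK.
have inC y s : K y -> 0 <= s -> s <= T -> cylinder (insert_coord 0 s y).
  by move=> Ky s0 sT; exists (y, s) => //; split=> //=; rewrite in_itv /= s0.
have dE y s : dot (intm u) (insert_coord 0 s y) =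
    (u 0 0)%:~R * s + dot (intm (u *m drop_mx 0 int)) y.
  by rewrite (dot_lift 0) insert_coordE insert_coord_drop mxE map_mxM map_drop_mx.
have [c0|c0] := eqVneq (u *m drop_mx 0 int) 0; last first.
  apply: le_trans (hT _ c0) _; rewrite directional_widthE.
  have [y [y' [Ky Ky' ->]]] := rwidth_attained (intm (u *m drop_mx 0 int)) bK.
  have := rwidth_ge (intm u) bC (inC y 0 Ky (lexx _) T0) (inC y' 0 Ky' (lexx _) T0).
  by rewrite !dE mulr0 !add0r.
have u1 : 1 <= `|(u 0 0)%:~R : R|.
  rewrite -intr_norm ler1z -gtz0_ge1 normr_gt0; apply: contra u0 => /eqP u00.
  apply/eqP/rowP => i; rewrite mxE; have [j ->|->//] := unliftP 0 i.
  by rewrite -mul_drop_mx c0 mxE.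
have h1 := rwidth_ge (intm u) bC (inC x T Kx T0 (lexx _)) (inC x 0 Kx (lexx _) T0).
have h2 := rwidth_ge (intm u) bC (inC x 0 Kx (lexx _) T0) (inC x T Kx T0 (lexx _)).
move: h1 h2; rewrite !dE mulr0 add0r addrK opprD addrCA subrr addr0 => h1 h2.
have h : `|(u 0 0)%:~R * T| <= rwidth cylinder (intm u) by rewrite ler_norml lerNl h2.
by apply: le_trans h; rewrite normrM (ger0_norm T0) ler_peMl.
Qed.

End Cylinder.

Lemma lattice_width_ge0 n (K : set 'rV[R]_n.+1) : convex_body K -> 0 <= lattice_width K.
Proof.
move=> bK; apply/(lattice_width_geP _ bK) => u _.
by rewrite directional_widthE rwidth_ge0.
Qed.

Lemma Flt_ge n k (F : R) (K : set 'rV[R]_n.+1) : Flt R n.+1 k = F%:E ->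
  admissible k K -> lattice_width K <= F.
Proof.
by move=> FE aK; rewrite -lee_fin -FE; apply: ereal_sup_ubound; exists K.
Qed.

Lemma unimod_lattice_width n (V : 'M[int]_n.+1) s (K : set 'rV[R]_n.+1) (w : R) :
  V \in unitmx -> convex_body K -> (forall u, u != 0 -> w <= directional_width K u) ->
  forall u, u != 0 -> w <= directional_width (unimod V s K) u.
Proof.
move=> uV bK hw u u0; rewrite directional_width_unimod//; apply: hw.
exact: mulmx_unit_neq0.
Qed.

Lemma lattice_width_box n (K : set 'rV[R]_n.+1) (D : R) : convex_body K ->
  (forall x, K x -> forall i, `|x 0 i| <= D) -> lattice_width K <= 2 * D.
Proof.
move=> bK KD; have e0 : delta_mx 0 0 != 0 :> 'rV[int]_n.+1.
  by apply/eqP => /rowP/(_ 0); rewrite !mxE !eqxx => /eqP; rewrite oner_eq0.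
apply: le_trans (lattice_width_le bK e0) _; rewrite directional_widthE.
have [x [y [Kx Ky ->]]] := rwidth_attained (intm (delta_mx 0 0)) bK.
have d0 v : dot (intm (delta_mx 0 0)) v = v 0 0 :> R.
  rewrite /dot (bigD1 0)//= !mxE !eqxx mul1r big1 ?addr0// => i i0.
  by rewrite !mxE (negbTE i0) andbF mul0r.
rewrite !d0; have := KD _ Kx 0; have := KD _ Ky 0; rewrite !ler_norml; lra.
Qed.

Lemma Flt_finite n k (W : R) : flat n W -> 0 <= W ->
  exists2 F, Flt R n.+1 k = F%:E & 0 <= F.
Proof.
move=> fW W0.
have [D hD] := unimodular_box k fW W0 (ltr_pwDr ltr01 (lexx W)).
have ub : (Flt R n.+1 k <= (Num.max (W + 1) (2 * D%:R))%:E)%E.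
  apply: ge_ereal_sup => _ [K [bK Kk] <-]; rewrite lee_fin le_max.
  have [//|/ltW h] := lerP (lattice_width K) (W + 1); apply/orP; right.
  have hw := (lattice_width_geP _ bK).1 h.
  have [V [s [uV VD]]] := hD K bK Kk hw.
  apply: le_trans (lattice_width_box (convex_body_aff _ _ bK) VD).
  apply/(lattice_width_geP _ (convex_body_aff _ _ bK)).
  by apply: unimod_lattice_width => // u u0; exact: lattice_width_le.
have [b0 l0] := origin_lattice_free n.
have lb : (0%:E <= Flt R n.+1 k)%E.
  apply: le_ereal_sup_tmp; exists (lattice_width [set (0 : 'rV[R]_n.+1)])%:E.
    by exists [set 0] => //; split=> //; exact: card_set0_le.
  by rewrite lee_fin lattice_width_ge0.
case: (Flt R n.+1 k) lb ub => [F||] //; rewrite !lee_fin => lb _.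
by exists F.
Qed.

(** [lower] turns wide bodies into configurations, and [upper] bounds by [F] every configuration of
    width at least [w0]. So the maximal [cfg_width] is exactly [F], and a deformation past [F]
    contradicts [upper]. *)
Lemma algebraic_of_flat n k (W F : R) : flat n W -> 0 <= W ->
  Flt R n.+1 k = F%:E -> W < F -> algebraicOver (ratr : rat -> R) F.
Proof.
move=> fW W0 FE WF.
pose w0 := (W + F) / 2.
have Ww0 : W < w0 by rewrite /w0; lra.
have w0F : w0 < F by rewrite /w0; lra.
have w00 : 0 < w0 by lra.
have [D0 hD0] := unimodular_box k fW W0 Ww0.
(* Enlarged beyond [F] because the width is one of the coordinates that a configuration bounds by
   [D]. *)
pose D := (D0 + (Num.truncn F).+1)%N.
have D_gt0 : (0 < D)%N by rewrite /D addnS.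
have FD : F <= D%:R.
  rewrite /D natrD; have := truncnS_gt F; have := ler0n R D0; lra.
have DD0 : D0%:R <= D%:R :> R by rewrite ler_nat leq_addr.
have A0 : 0 <= n.+1%:R * (2 * D%:R) :> R by rewrite !mulr_ge0.
have [kap [M0 [kap0 hkap]]] := seminorm_coercive n.+1 A0 w00.
(* Directions up to [M0] trigger coercivity; [M] is large enough for coercivity to give width at
   least [F + 1] in every direction with an entry beyond [M]. *)
pose M := (M0 + (Num.truncn ((F + 1) / kap)).+1)%N.
have MF : F + 1 <= kap * M.+1%:R.
  rewrite mulrC -ler_pdivrMr// /M -addnS natrD.
  have := truncnS_gt ((F + 1) / kap); have := ler0n R M0.
  rewrite -[X in _ -> _ -> _ <= _ + X]natr1; lra.
have upper (S : {set @lattice_box n.+1 D}) v :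
    (#|S| <= k)%N -> @config R n D M S v -> w0 <= cfg_width v -> cfg_width v <= F.
  move=> Sk cv wv.
  have [K [bK Kk KD Kw]] := body_of_config Sk cv.
  have wide (u : 'rV[int]_n.+1) : u != 0 -> (forall i, (`|u 0%R i| <= M0)%N) ->
      w0 <= rwidth K (intm u).
    move=> u0 uM; rewrite -directional_widthE; apply: le_trans wv (Kw u u0 _).
    by move=> i; rewrite (leq_trans (uM i))// leq_addr.
  have sK : seminorm (rwidth K) by split=> *; [exact: rwidthD|exact: rwidthZ].
  have NA (z : 'rV[R]_n.+1) e : (forall i, `|z 0 i| <= e) ->
      rwidth K z <= n.+1%:R * (2 * D%:R) * e.
    move=> ze; have [x [y [Kx Ky ->]]] := rwidth_attained z bK.
    rewrite -dotBr -mulrA [_ * e]mulrC; apply: dot_le => // i; rewrite !mxE.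
    apply: le_trans (ler_normB _ _) _.
    by have := KD _ Kx i; have := KD _ Ky i; lra.
  have coer := hkap _ sK NA wide.
  rewrite leNgt; apply/negP => Fv.
  (* Directions within [M] have width at least [cfg_width v], the others at least [F + 1]; both
     would exceed the supremum [F]. *)
  suff : Num.min (cfg_width v) (F + 1) <= lattice_width K.
    have := Flt_ge FE (conj bK Kk); rewrite leNgt => /negP h1 h2; apply: h1.
    by apply: lt_le_trans h2; rewrite lt_min Fv ltrDl ltr01.
  apply/(lattice_width_geP _ bK) => u u0; rewrite ge_min.
  have [uM|] := pselect (forall i, (`|u 0%R i| <= M)%N).
    by rewrite Kw.
  move=> /existsNP[i /negP]; rewrite -ltnNge => uM.
  apply/orP; right; apply: le_trans MF _; rewrite directional_widthE.
  apply: le_trans (coer (intm u) i).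
  rewrite ler_pM2l// mxE -intr_norm -abszE -pmulrn ler_nat//.
have lower (K : set 'rV[R]_n.+1) w : admissible k K -> w0 <= w -> w <= lattice_width K ->
    exists (S : {set @lattice_box n.+1 D}) v,
      [/\ (#|S| <= k)%N, @config R n D M S v & cfg_width v = w].
  move=> [bK Kk] ww hw.
  have hw1 := (lattice_width_geP _ bK).1 hw.
  have [V [s [uV VD]]] := hD0 K bK Kk (fun u u0 => le_trans ww (hw1 u u0)).
  apply: (@config_of_body R n D M k (unimod V s K)) => //.
  - exact: convex_body_aff.
  - exact: card_unimod.
  - by move=> x Kx i; exact: le_trans (VD x Kx i) DD0.
  - lra.
  - by apply: le_trans FD; apply: le_trans hw (Flt_ge FE (conj bK Kk)).
  - exact: unimod_lattice_width.
have near_sup e : e < F ->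
    exists2 K : set 'rV[R]_n.+1, admissible k K & e < lattice_width K.
  rewrite -lte_fin -FE => /ereal_sup_gt[_ [K aK <-]]; rewrite lte_fin => h.
  by exists K.
have [S [v [Sk cv vmax]]] : exists (S : {set @lattice_box n.+1 D}) v,
  [/\ (#|S| <= k)%N, @config R n D M S v &
    forall (S' : {set @lattice_box n.+1 D}) v',
      (#|S'| <= k)%N -> @config R n D M S' v' -> cfg_width v' <= cfg_width v].
  apply: config_max; have [K aK wK] := near_sup _ w0F.
  by have [S [v [Sk cv _]]] := lower K w0 aK (lexx _) (ltW wK); exists S, v.
have vF : cfg_width v = F.
  have Fv : F <= cfg_width v.
    rewrite leNgt; apply/negP => vF.
    have mF : Num.max w0 (cfg_width v) < F by rewrite gt_max w0F vF.
    have [K aK] := near_sup _ mF.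
    rewrite gt_max => /andP[h1 h2].
    have [S' [v' [Sk' cv' wv']]] := lower K _ aK (ltW h1) (lexx _).
    by have := vmax _ _ Sk' cv'; rewrite wv' leNgt h2.
  apply/eqP; rewrite eq_le Fv andbT; apply: (upper S) => //.
  exact: le_trans (ltW w0F) Fv.
apply: contrapT; rewrite -vF => na.
have [v' cv' vv'] := config_deform na cv.
rewrite vF in vv'.
have /(upper S v' Sk cv') : w0 <= cfg_width v' by exact: ltW (lt_trans w0F vv').
by rewrite leNgt vv'.
Qed.

(** The only body in dimension 0 is the whole space, which contains the origin in its interior: no
    body is lattice-free. *)
Lemma flat0 : flat 0 (0 : R).
Proof.
move=> K w [[x Kx] _ _] K0; exfalso.
suff : interior_lattice_points K 0 by rewrite K0.
apply/interior_rowP; exists 1 => // y _.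
by rewrite (thinmx0 y) -(thinmx0 x).
Qed.

Lemma Flt_algebraic_step n k (W : R) : flat n W -> 0 <= W ->
  algebraicOver (ratr : rat -> R) W -> (forall F, Flt R n.+1 k = F%:E -> W <= F) ->
  exists2 x : R, Flt R n.+1 k = x%:E & algebraicOver (ratr : rat -> R) x.
Proof.
move=> fW W0 aW WF; have [F FE F0] := Flt_finite k fW W0.
exists F => //; have := WF F FE; rewrite le_eqVlt => /orP[/eqP <-//|].
exact: algebraic_of_flat fW W0 FE.
Qed.

Lemma Flt_algebraic n k :
  exists2 x : R, Flt R n.+1 k = x%:E & algebraicOver (ratr : rat -> R) x.
Proof.
elim: n k => [|n IHn] k.
  apply: (Flt_algebraic_step flat0) => //; first exact: algebraic0.
  by move=> F; have [F' -> F0] := Flt_finite k flat0 (lexx 0) => -[<-].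
(* The induction hypothesis is taken at 0 interior points for every [k], since the projections in
   [segment_bound] are compared with lattice-free bodies only. *)
have [W WE aW] := IHn 0%N.
have W_ge (K : set 'rV[R]_n.+1) : convex_body K ->
    interior_lattice_points K = set0 -> lattice_width K <= W.
  by move=> bK K0; apply: (Flt_ge WE); split=> //; exact: card_set0_le.
have W0 : 0 <= W.
  have [b0 l0] := origin_lattice_free n.
  exact: le_trans (lattice_width_ge0 b0) (W_ge _ b0 l0).
apply: (Flt_algebraic_step (W := W)) => //.
  move=> K w bK K0 hw; apply: le_trans (W_ge K bK K0).
  exact/(lattice_width_geP _ bK).
move=> F FE; rewrite -lee_fin -WE; apply: ge_ereal_sup => _ [K [bK K0] <-].
move: K0; rewrite II0 card_le0 => /eqP K0.
have T0 := lattice_width_ge0 bK.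
(* A height equal to the width of the base is enough for the vertical directions not to lower the
   width. *)
rewrite lee_fin; pose C := cylinder K (lattice_width K).
have bC : convex_body C by exact: convex_body_cylinder.
apply: le_trans (_ : lattice_width C <= _).
  apply/(lattice_width_geP _ bC) => u u0; apply: cylinder_width => //.
  by move=> c c0; exact: lattice_width_le.
apply: (Flt_ge FE); split=> //; apply: card_set0_le.
exact: cylinder_lattice_free.
Qed.

End Main.

Theorem theorem2p22 (R : realType) (d k : nat) (hd : (1 <= d)%N) :
  exists2 x : R, Flt R d k = x%:E & algebraicOver (ratr : rat -> R) x.
Proof. by case: d hd => // n _; exact: Flt_algebraic. Qed.
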